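(* Let $A = \varinjlim\bigl(A_n, (\Lambda_{m,n})_{m\ge n}\bigr)$ be the direct limit C*-algebra constructed in the context. Then $A$ is stably finite and simple, and has stable rank one.
   Context: Construction. For $n \in \mathbb{Z}_{\ge 0}$ set $d(n) = 2^{n+1}-1$, $l(n) = 2^{n+1}$, $r(0)=1$ and $r(n) = \prod_{k=1}^n 2^{k+1}$, $s(0)=1$ and $s(n) = \prod_{k=1}^n (2^{k+1}-1)$. Let $X_n = (S^2)^{s(n)}$, so that $X_{n+1} = X_n^{d(n+1)}$; for $\nu = 1,\dots,d(n+1)$ let $P^{(n)}_\nu \colon X_{n+1}\to X_n$ be the $\nu$-th coordinate projection. Choose points $x_m \in X_m$ for $m \in \mathbb{Z}_{\ge 0}$ such that for all $n \in \mathbb{Z}_{\geq 0}$ the set \[ \bigl\{ \bigl(P^{(n)}_{\nu_1}\circ P^{(n+1)}_{\nu_2}\circ\cdots\circ P^{(m-1)}_{\nu_{m-n}}\bigr)(x_m) : m = n, n+1, \dots,\ \nu_j = 1,\dots,d(n+j) \text{ for } j=1,\dots,m-n \bigr\} \] is dense in $X_n$ (for $m=n$ the contribution is $x_n$). Let $A_n = [C(X_n)\oplus C(X_n)]\otimes M_{r(n)}$. Define unital homomorphisms $\lambda_n \colon C(X_n)\oplus C(X_n) \to M_{l(n+1)}\bigl[C(X_{n+1})\oplus C(X_{n+1})\bigr]$ by \[ \lambda_n(f,g) = \Bigl(\operatorname{diag}\bigl(f\circ P^{(n)}_1,\dots,f\circ P^{(n)}_{d(n+1)}, g(x_n)\bigr),\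 \operatorname{diag}\bigl(g\circ P^{(n)}_1,\dots,g\circ P^{(n)}_{d(n+1)}, f(x_n)\bigr)\Bigr), \] where $g(x_n), f(x_n)$ are regarded as constant functions on $X_{n+1}$. Let $\Lambda_{n+1,n} = \lambda_n\otimes \operatorname{id}_{M_{r(n)}}\colon A_n\to A_{n+1}$ (identifying $M_{l(n+1)}\otimes M_{r(n)}$ with $M_{r(n+1)}$), and $\Lambda_{m,n} = \Lambda_{m,m-1}\circ\cdots\circ\Lambda_{n+1,n}$. Then $A = \varinjlim(A_n, (\Lambda_{m,n})_{m\ge n})$. A unital C*-algebra has stable rank one if its invertible elements are dense. *)

(* Defs.v *)
From HB Require Import structures.
From mathcomp Require Import all_boot all_order all_algebra.
From mathcomp Require Import complex mxtens.
From mathcomp Require Import all_classical all_reals topology normedtype.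

Set Implicit Arguments.
Unset Strict Implicit.
Unset Printing Implicit Defensive.

Import Order.TTheory GRing.Theory Num.Theory.
Import numFieldNormedType.Exports.

Local Open Scope classical_set_scope.
Local Open Scope complex_scope.
Local Open Scope ring_scope.

HB.mixin Record isStarAlgebra (R : realType) A of GRing.Algebra R[i] A := {
  star : A -> A ;
  starK : involutive star ;
  starD : {morph star : a b / a + b} ;
  starZ : forall (c : R[i]) (a : A), star (c *: a) = c^* *: star a ;
  starM : forall a b : A, star (a * b) = star b * star a }.

#[short(type="starAlgType")]
HB.structure Definition StarAlgebra (R : realType) :=
  {A of GRing.Algebra R[i] A & isStarAlgebra R A}.

(* The norm is a field of its own, rather than inherited from
   completeNormedModType, because the algebraic and the normed hierarchies of
   the library have no common substructure that carries both a noncommutative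
   product and a norm. *)
HB.mixin Record isCStarAlgebra (R : realType) A of StarAlgebra R A := {
  cnorm : A -> R ;
  cnorm_eq0 : forall a : A, cnorm a = 0 -> a = 0 ;
  cnormD : forall a b : A, cnorm (a + b) <= cnorm a + cnorm b ;
  cnormZ : forall (c : R[i]) (a : A), cnorm (c *: a) = Normc.normc c * cnorm a ;
  cnormM : forall a b : A, cnorm (a * b) <= cnorm a * cnorm b ;
  cnorm_star : forall a : A, cnorm (star a * a) = cnorm a ^+ 2 ;
  cnorm_complete : forall u : nat -> A,
    (forall e : R, 0 < e -> exists N : nat, forall m n : nat,
       (N <= m)%N -> (N <= n)%N -> cnorm (u m - u n) < e) ->
    exists a : A, cnorm (u n - a) @[n --> \oo] --> (0 : R) }.

#[short(type="cstarAlgType")]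
HB.structure Definition CStarAlgebra (R : realType) :=
  {A of StarAlgebra R A & isCStarAlgebra R A}.

Definition is_star_hom (R : realType) (A B : starAlgType R) (f : A -> B) :=
  [/\ linear f, GRing.monoid_morphism f & {morph f : a / star a}].

Section StarPair.
Variables (R : realType) (A B : starAlgType R).
Implicit Types x y : (A * B)%type.

Definition pair_star x : A * B := (star x.1, star x.2).

Lemma pair_starK : involutive pair_star.
Proof. by case=> a b; rewrite /pair_star /= !starK. Qed.

Lemma pair_starD : {morph pair_star : x y / x + y}.
Proof. by move=> x y; rewrite /pair_star /= !starD. Qed.

Lemma pair_starZ (c : R[i]) x : pair_star (c *: x) = c^* *: pair_star x.
Proof. by rewrite /pair_star /= !starZ. Qed.

Lemma pair_starM x y : pair_star (x * y) = pair_star y * pair_star x.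
Proof. by rewrite /pair_star /= !starM. Qed.

HB.instance Definition _ := isStarAlgebra.Build R (A * B)%type
  pair_starK pair_starD pair_starZ pair_starM.

End StarPair.

(* An alias of 'M[A]_n, because the library makes 'M[A]_n a module over A,
   while M_n(A) is needed here as an algebra over the complex numbers. The
   argument n_gt0 is what makes M_n(A) a nonzero ring. *)
Definition matalg (A : Type) (n : nat) (n_gt0 : (0 < n)%N) : Type := 'M[A]_n.

Section MatAlg.
Variables (R : realType) (A : starAlgType R) (n : nat) (n_gt0 : (0 < n)%N).
Local Notation MA := (matalg A n_gt0).
Implicit Types (M N : 'M[A]_n) (c : R[i]).

HB.instance Definition _ := GRing.PzRing.copy MA 'M[A]_n.

Lemma mat_oner_neq0 : (1 : MA) != 0.
Proof.
apply/eqP=> /matrixP /(_ (Ordinal n_gt0) (Ordinal n_gt0)) /eqP.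
by rewrite !mxE eqxx oner_eq0.
Qed.

HB.instance Definition _ := GRing.PzSemiRing_isNonZero.Build MA mat_oner_neq0.

Definition mat_scale c M : 'M[A]_n := map_mx ( *:%R c) M.
Definition mat_star M : 'M[A]_n := (map_mx star M)^T.

Lemma mat_scaleA c d M : mat_scale c (mat_scale d M) = mat_scale (c * d) M.
Proof. by apply/matrixP=> i j; rewrite !mxE scalerA. Qed.

Lemma mat_scale1 : left_id 1 mat_scale.
Proof. by move=> M; apply/matrixP=> i j; rewrite !mxE scale1r. Qed.

Lemma mat_scaleDr : right_distributive mat_scale +%R.
Proof. by move=> c M N; apply/matrixP=> i j; rewrite !mxE scalerDr. Qed.

Lemma mat_scaleDl M : {morph mat_scale^~ M : c d / c + d}.
Proof. by move=> c d; apply/matrixP=> i j; rewrite !mxE scalerDl. Qed.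

HB.instance Definition _ := GRing.Zmodule_isLmodule.Build R[i] MA
  mat_scaleA mat_scale1 mat_scaleDr mat_scaleDl.

Lemma mat_scale_mull c M N : mat_scale c (M *m N) = mat_scale c M *m N.
Proof.
apply/matrixP=> i j; rewrite !mxE scaler_sumr.
by apply: eq_bigr=> k _; rewrite !mxE scalerAl.
Qed.

Lemma mat_scale_mulr c M N : mat_scale c (M *m N) = M *m mat_scale c N.
Proof.
apply/matrixP=> i j; rewrite !mxE scaler_sumr.
by apply: eq_bigr=> k _; rewrite !mxE scalerAr.
Qed.

Lemma mat_starK : involutive mat_star.
Proof. by move=> M; apply/matrixP=> i j; rewrite !mxE starK. Qed.

Lemma mat_starD : {morph mat_star : M N / M + N}.
Proof. by move=> M N; apply/matrixP=> i j; rewrite !mxE starD. Qed.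

Lemma mat_starZ c M : mat_star (mat_scale c M) = mat_scale c^* (mat_star M).
Proof. by apply/matrixP=> i j; rewrite !mxE starZ. Qed.

Lemma star0 : star (0 : A) = 0.
Proof. by apply: (addrI (star (0 : A))); rewrite -starD !addr0. Qed.

Lemma mat_starM M N : mat_star (M *m N) = mat_star N *m mat_star M.
Proof.
apply/matrixP=> i j; rewrite !mxE (big_morph _ (@starD R A) star0).
by apply: eq_bigr=> k _; rewrite !mxE starM.
Qed.

HB.instance Definition _ :=
  GRing.Lmodule_isLalgebra.Build R[i] MA mat_scale_mull.
HB.instance Definition _ :=
  GRing.Lalgebra_isAlgebra.Build R[i] MA mat_scale_mulr.
HB.instance Definition _ := isStarAlgebra.Build R MA mat_starK
  mat_starD mat_starZ mat_starM.

Lemma matalgD (a b : MA) i j : (a + b) i j = a i j + b i j.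
Proof. exact: mxE. Qed.

Lemma matalgZ c (a : MA) i j : (c *: a) i j = c *: a i j.
Proof. exact: mxE. Qed.

Lemma matalg1 i j : (1 : MA) i j = (i == j)%:R.
Proof. exact: mxE. Qed.

Lemma matalgM (a b : MA) i j : (a * b) i j = \sum_k a i k * b k j.
Proof. exact: mxE. Qed.

Lemma matalg_star (a : MA) i j : star a i j = star (a j i).
Proof. by rewrite [LHS]mxE mxE. Qed.

End MatAlg.

(* R[i]^o is R[i] with its norm topology. *)
Definition cfun (R : realType) (X : ptopologicalType) : Type :=
  continuousType X R[i]^o.

Section ContinuousFunctions.
Variables (R : realType) (X : ptopologicalType).
Local Notation C := (R[i]^o : normedModType R[i]).
Local Notation CX := (cfun R X).

HB.instance Definition _ := Choice.on CX.

Definition cfun_eval (f : CX) : X -> R[i] := (f : continuousType X R[i]^o).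

Lemma cfunP (f g : CX) : cfun_eval f =1 cfun_eval g -> f = g.
Proof. by move=> fg; exact/continuousEP. Qed.

Lemma cfun_continuous (f : CX) : continuous (cfun_eval f : X -> R[i]^o).
Proof. exact: cts_fun. Qed.

Definition mkcfun (f : X -> R[i]^o) (cf : continuous f) : CX := mkcts cf.

Lemma conj_continuous : continuous (fun z : R[i]^o => z^* : R[i]^o).
Proof.
move=> z; have Fz := nbhs_filter (z : R[i]^o).
apply/(@cvgrPdist_lt _ C _ _ Fz) => e e0.
have := @cvgr_dist_lt _ C _ _ Fz id z (fun U => id) _ e0.
apply: filterS => w; rewrite -rmorphB.
by case: (z - w) => a b; rewrite !normc_def /= sqrrN.
Qed.

Lemma cfun_cst_continuous (c : R[i]) : continuous (fun _ : X => c : R[i]^o).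
Proof. by move=> x; exact: cvg_cst. Qed.
Lemma cfun_add_continuous (f g : CX) :
  continuous (fun x => cfun_eval f x + cfun_eval g x : R[i]^o).
Proof. by move=> x; apply: (@continuousD R[i] C); exact: cfun_continuous. Qed.
Lemma cfun_opp_continuous (f : CX) :
  continuous (fun x => - cfun_eval f x : R[i]^o).
Proof. by move=> x; apply: (@continuousN R[i] C); exact: cfun_continuous. Qed.
Lemma cfun_mul_continuous (f g : CX) :
  continuous (fun x => cfun_eval f x * cfun_eval g x : R[i]^o).
Proof. by move=> x; apply: continuousM; exact: cfun_continuous. Qed.
Lemma cfun_conj_continuous (f : CX) :
  continuous (fun x => (cfun_eval f x)^* : R[i]^o).
Proof.
move=> x; apply: (@continuous_comp _ _ _ (cfun_eval f : X -> R[i]^o)).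
- exact: cfun_continuous.
- exact: conj_continuous.
Qed.

Definition cfun_cst c : CX := mkcfun (@cfun_cst_continuous c).
Definition cfun_add f g : CX := mkcfun (@cfun_add_continuous f g).
Definition cfun_opp f : CX := mkcfun (@cfun_opp_continuous f).
Definition cfun_mul f g : CX := mkcfun (@cfun_mul_continuous f g).
Definition cfun_star f : CX := mkcfun (@cfun_conj_continuous f).
Definition cfun_scale (c : R[i]) (f : CX) : CX := cfun_mul (cfun_cst c) f.

Lemma cfun_addA : associative cfun_add.
Proof. by move=> f g h; apply: cfunP=> x; exact: addrA. Qed.
Lemma cfun_addC : commutative cfun_add.
Proof. by move=> f g; apply: cfunP=> x; exact: addrC. Qed.
Lemma cfun_add0 : left_id (cfun_cst 0) cfun_add.
Proof. by move=> f; apply: cfunP=> x; exact: add0r. Qed.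
Lemma cfun_addN : left_inverse (cfun_cst 0) cfun_opp cfun_add.
Proof. by move=> f; apply: cfunP=> x; exact: addNr. Qed.
HB.instance Definition _ := GRing.isZmodule.Build CX
  cfun_addA cfun_addC cfun_add0 cfun_addN.

Lemma cfun_mulA : associative cfun_mul.
Proof. by move=> f g h; apply: cfunP=> x; exact: mulrA. Qed.
Lemma cfun_mul1 : left_id (cfun_cst 1) cfun_mul.
Proof. by move=> f; apply: cfunP=> x; exact: mul1r. Qed.
Lemma cfun_mulr1 : right_id (cfun_cst 1) cfun_mul.
Proof. by move=> f; apply: cfunP=> x; exact: mulr1. Qed.
Lemma cfun_mulDl : left_distributive cfun_mul +%R.
Proof. by move=> f g h; apply: cfunP=> x; exact: mulrDl. Qed.
Lemma cfun_mulDr : right_distributive cfun_mul +%R.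
Proof. by move=> f g h; apply: cfunP=> x; exact: mulrDr. Qed.
HB.instance Definition _ := GRing.Zmodule_isPzRing.Build CX
  cfun_mulA cfun_mul1 cfun_mulr1 cfun_mulDl cfun_mulDr.

Lemma cfun_oner_neq0 : (1 : CX) != 0.
Proof.
apply/eqP=> /(congr1 (fun f : CX => cfun_eval f point)) /eqP.
by rewrite /cfun_eval /= oner_eq0.
Qed.
HB.instance Definition _ := GRing.PzSemiRing_isNonZero.Build CX cfun_oner_neq0.

Lemma cfun_scaleA c d f : cfun_scale c (cfun_scale d f) = cfun_scale (c * d) f.
Proof. by apply: cfunP=> x; exact: mulrA. Qed.
Lemma cfun_scale1 : left_id 1 cfun_scale.
Proof. by move=> f; apply: cfunP=> x; exact: mul1r. Qed.
Lemma cfun_scaleDr : right_distributive cfun_scale +%R.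
Proof. by move=> c f g; apply: cfunP=> x; exact: mulrDr. Qed.
Lemma cfun_scaleDl f : {morph cfun_scale^~ f : c d / c + d}.
Proof. by move=> c d; apply: cfunP=> x; exact: mulrDl. Qed.
HB.instance Definition _ := GRing.Zmodule_isLmodule.Build R[i] CX
  cfun_scaleA cfun_scale1 cfun_scaleDr cfun_scaleDl.

Lemma cfun_scale_mull (c : R[i]) (f g : CX) : c *: (f * g) = (c *: f) * g.
Proof. exact: mulrA. Qed.
Lemma cfun_scale_mulr (c : R[i]) (f g : CX) : c *: (f * g) = f * (c *: g).
Proof. by apply: cfunP=> x; exact: mulrCA. Qed.
HB.instance Definition _ :=
  GRing.Lmodule_isLalgebra.Build R[i] CX cfun_scale_mull.
HB.instance Definition _ :=
  GRing.Lalgebra_isAlgebra.Build R[i] CX cfun_scale_mulr.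

Lemma cfun_starK : involutive cfun_star.
Proof. by move=> f; apply: cfunP=> x; exact: conjcK. Qed.
Lemma cfun_starD : {morph cfun_star : f g / f + g}.
Proof. by move=> f g; apply: cfunP=> x; exact: rmorphD. Qed.
Lemma cfun_starZ (c : R[i]) (f : CX) : cfun_star (c *: f) = c^* *: cfun_star f.
Proof. by apply: cfunP=> x; exact: rmorphM. Qed.
Lemma cfun_starM (f g : CX) : cfun_star (f * g) = cfun_star g * cfun_star f.
Proof.
apply: cfunP=> x; rewrite [RHS](mulrC ((cfun_eval g x)^*)).
exact: rmorphM.
Qed.
HB.instance Definition _ := isStarAlgebra.Build R CX
  cfun_starK cfun_starD cfun_starZ cfun_starM.

End ContinuousFunctions.

Definition cfun_comp (R : realType) (X Y : ptopologicalType)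
    (p : continuousType Y X) (f : cfun R X) : cfun R Y :=
  [the continuousType Y R[i]^o of (f : continuousType X R[i]^o) \o p].

Section DirectLimit.
Variable R : realType.

Fixpoint transition (S : nat -> starAlgType R) (L : forall n, S n -> S n.+1)
    (n k : nat) : S n -> S (k + n)%N :=
  match k return S n -> S (k + n)%N with
  | 0 => fun a => a
  | k'.+1 => fun a => L (k' + n)%N (transition L k' a)
  end.

Definition is_cocone (S : nat -> starAlgType R) (L : forall n, S n -> S n.+1)
    (B : cstarAlgType R) (psi : forall n, S n -> B) : Prop :=
  (forall n, is_star_hom (psi n)) /\
  (forall n k (a : S n), psi (k + n)%N (transition L k a) = psi n a).

(* The universal property of the direct limit in the category of unital
   C*-algebras and unital *-homomorphisms. The S n are meant to be C*-algebras;
   their norms do not appear because a *-homomorphism of C*-algebras is just a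
   *-homomorphism of the underlying *-algebras (it is automatically
   contractive, and the C*-norm of a C*-algebra is unique). The zero algebra is
   not a test object B; every cocone to it factors uniquely anyway. *)
Definition is_cstar_direct_limit (S : nat -> starAlgType R)
    (L : forall n, S n -> S n.+1)
    (A : cstarAlgType R) (iota : forall n, S n -> A) : Prop :=
  is_cocone L iota /\
  forall (B : cstarAlgType R) (psi : forall n, S n -> B), is_cocone L psi ->
    exists! phi : A -> B,
      is_star_hom phi /\ forall n (a : S n), phi (iota n a) = psi n a.

End DirectLimit.

Section Properties.
Variable R : realType.

Definition finite_algebra (M : starAlgType R) : Prop :=
  forall v : M, star v * v = 1 -> v * star v = 1.

Definition stably_finite (A : cstarAlgType R) : Prop :=
  forall (n : nat) (n_gt0 : (0 < n)%N), finite_algebra (matalg A n_gt0).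

Definition norm_closure (A : cstarAlgType R) (S : set A) : set A :=
  [set a | forall e : R, 0 < e -> exists2 b, S b & cnorm (a - b) < e].

Definition two_sided_ideal (A : cstarAlgType R) (I : set A) : Prop :=
  [/\ I 0,
      forall a b, I a -> I b -> I (a + b),
      forall (c : R[i]) a, I a -> I (c *: a),
      forall a b, I b -> I (a * b) &
      forall a b, I a -> I (a * b)].

(* A <> 0 holds by construction, as algType excludes the zero ring. *)
Definition simple_algebra (A : cstarAlgType R) : Prop :=
  forall I : set A, norm_closure I `<=` I -> two_sided_ideal I ->
    I = [set 0] \/ I = setT.

Definition invertible (A : cstarAlgType R) (a : A) : Prop :=
  exists b : A, a * b = 1 /\ b * a = 1.

Definition stable_rank_one (A : cstarAlgType R) : Prop :=
  norm_closure [set a : A | invertible a] = setT.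

End Properties.

Definition d (n : nat) : nat := (2 ^ n.+1 - 1)%N.
Definition l (n : nat) : nat := (2 ^ n.+1)%N.
Fixpoint r (n : nat) : nat := if n is m.+1 then (l m.+1 * r m)%N else 1.
Fixpoint s (n : nat) : nat := if n is m.+1 then (d m.+1 * s m)%N else 1.

Lemma rE n : r n = (\prod_(1 <= k < n.+1) 2 ^ k.+1)%N.
Proof.
elim: n => [|n IH]; first by rewrite big_geq.
by rewrite big_nat_recr //= IH mulnC.
Qed.

Lemma sE n : s n = (\prod_(1 <= k < n.+1) (2 ^ k.+1 - 1))%N.
Proof.
elim: n => [|n IH]; first by rewrite big_geq.
by rewrite big_nat_recr //= IH mulnC.
Qed.

Lemma l_gt0 n : (0 < l n)%N.
Proof. by rewrite expn_gt0. Qed.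

Lemma r_gt0 n : (0 < r n)%N.
Proof. by elim: n => [|n IH] //=; rewrite muln_gt0 l_gt0. Qed.

Section Construction.
Variable R : realType.

Definition sphere2 : set (R * R * R)%type :=
  [set p | p.1.1 ^+ 2 + p.1.2 ^+ 2 + p.2 ^+ 2 = 1].

Definition S2 : Type := set_type sphere2.
HB.instance Definition _ := Topological.on S2.

Lemma north_pole_subproof : ((0, 0, 1) : R * R * R) \in sphere2.
Proof. by rewrite inE /sphere2 /= !expr0n expr1n !add0r. Qed.
Definition north_pole : S2 :=
  exist (fun p => p \in sphere2) _ north_pole_subproof.
HB.instance Definition _ := isPointed.Build S2 north_pole.

Definition X (n : nat) : Type := 'I_(s n) -> S2.
HB.instance Definition _ n := Topological.copy (X n) {ptws 'I_(s n) -> S2}.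
HB.instance Definition _ n := isPointed.Build (X n) (fun=> north_pole).

(* X (n+1) = (X n)^d(n+1) through 'I_(s (n+1)) = 'I_(d (n+1) * s n), which
   mxtens_index identifies with pairs of indices. Coordinates are numbered from
   0 here. *)
Definition proj_fun (n : nat) (nu : 'I_(d n.+1)) (x : X n.+1) : X n :=
  fun i => x (mxtens_index (nu, i)).

Lemma proj_fun_continuous n (nu : 'I_(d n.+1)) : continuous (@proj_fun n nu).
Proof.
move=> x; have Fx := nbhs_filter x.
apply/(@cvg_sup _ _ _ _ _ (fmap_filter _ Fx)) => i; move: x Fx => x _; move: x.
apply: (@continuous_comp_initial (X n) (X n.+1) S2 (fun y => y i)) => x.
exact: (@proj_continuous _ (fun=> S2) (mxtens_index (nu, i)) x).
Qed.

Definition P (n : nat) (nu : 'I_(d n.+1)) : continuousType (X n.+1) (X n) :=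
  mkcts (@proj_fun_continuous n nu).

Inductive proj_composite (n : nat) : forall m, (X m -> X n) -> Prop :=
| proj_composite_id : proj_composite (fun x : X n => x)
| proj_composite_step m (f : X m -> X n) (nu : 'I_(d m.+1)) :
    proj_composite f -> proj_composite (f \o P nu).

Definition dense_orbits (x : forall m, X m) : Prop :=
  forall n, dense [set y : X n |
    exists (m : nat) (f : X m -> X n), proj_composite f /\ y = f (x m)].

Definition C2 (n : nat) : starAlgType R := (cfun R (X n) * cfun R (X n))%type.

Definition Aalg (n : nat) : starAlgType R := matalg (C2 n) (r_gt0 n).

Definition lambda_entry (x : forall m, X m) (n : nat) (nu : 'I_(l n.+1))
    (fg : C2 n) : C2 n.+1 :=
  if insub (val nu) is Some j then
    (cfun_comp (P j) fg.1, cfun_comp (P j) fg.2)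
  else
    (cfun_cst _ (cfun_eval fg.2 (x n)), cfun_cst _ (cfun_eval fg.1 (x n))).

(* An element of M_l(C(X) (+) C(X)) is a matrix of pairs rather than a pair of
   matrices. *)
Definition lambda (x : forall m, X m) (n : nat) (fg : C2 n) :
    matalg (C2 n.+1) (l_gt0 n.+1) :=
  diag_mx (\row_nu lambda_entry x nu fg).

(* lambda_n (x) id on M_r(n), under the Kronecker identification of
   M_l(n+1) (x) M_r(n) with M_r(n+1). *)
Definition Lambda (x : forall m, X m) (n : nat) (a : Aalg n) : Aalg n.+1 :=
  \matrix_(p < l n.+1 * r n, q < l n.+1 * r n)
    (lambda x (a (mxtens_unindex p).2 (mxtens_unindex q).2) : 'M_ _)
      (mxtens_unindex p).1 (mxtens_unindex q).1.

Lemma lambda_entry_star_hom (x : forall m, X m) n (nu : 'I_(l n.+1)) :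
  is_star_hom (@lambda_entry x n nu).
Proof.
rewrite /lambda_entry; case: insubP => [j _ _|_]; split.
- by move=> c [f g] [f' g']; congr pair; apply: cfunP.
- by split=> [|[f g] [f' g']]; congr pair; apply: cfunP.
- by case=> f g; congr pair; apply: cfunP.
- by move=> c [f g] [f' g']; congr pair; apply: cfunP.
- by split=> [|[f g] [f' g']]; congr pair; apply: cfunP.
- by case=> f g; congr pair; apply: cfunP.
Qed.

Lemma LambdaE (x : forall m, X m) n (a : Aalg n) nu i mu j :
  (Lambda x a : 'M_(l n.+1 * r n)) (mxtens_index (nu, i)) (mxtens_index (mu, j))
  = if nu == mu then lambda_entry x nu ((a : 'M_(r n)) i j) else 0.
Proof.
rewrite /Lambda mxE !mxtens_indexK /= /lambda !mxE.
by case: eqVneq => [->|_]; rewrite ?mulr1n ?mulr0n.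
Qed.

Lemma Lambda_star_hom (x : forall m, X m) n : is_star_hom (@Lambda x n).
Proof.
have hom nu := lambda_entry_star_hom x (nu : 'I_(l n.+1)).
have hD nu : {morph @lambda_entry x n nu : a b / a + b}.
  by case: (hom nu) => lin _ _ a b; have := lin 1 a b; rewrite !scale1r.
have h0 nu : @lambda_entry x n nu 0 = 0.
  by apply: (addrI (lambda_entry x nu 0)); rewrite -hD !addr0.
split.
- move=> c a b; apply/matrixP=> p q.
  case: (mxtens_indexP (p : 'I_(l n.+1 * r n)))
      (mxtens_indexP (q : 'I_(l n.+1 * r n))) => nu i [mu j].
  have [lin _ _] := hom nu.
  rewrite [LHS]LambdaE matalgD matalgZ [RHS]matalgD matalgZ !LambdaE.
  case: eqVneq => _; first exact: lin.
  by rewrite scaler0 addr0.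
- split=> [|a b]; apply/matrixP=> p q;
    case: (mxtens_indexP (p : 'I_(l n.+1 * r n)))
      (mxtens_indexP (q : 'I_(l n.+1 * r n))) => nu i [mu j];
    have [_ [one mul] _] := hom nu; rewrite [LHS]LambdaE.
  + rewrite !matalg1 (can_eq (@mxtens_indexK _ _)) xpair_eqE.
    by case: (nu == mu) (i == j) => -[]; rewrite ?one ?h0.
  + rewrite !matalgM (reindex (@mxtens_index _ _)); last first.
      exact: onW_bij
        (Bijective (@mxtens_indexK _ _) (@mxtens_unindexK _ _)).
    pose F k1 k2 := (if nu == k1 then lambda_entry x nu (a i k2) else 0) *
                    (if k1 == mu then lambda_entry x k1 (b k2 j) else 0).
    transitivity (\sum_k1 \sum_k2 F k1 k2); last first.
      rewrite pair_bigA; apply: eq_bigr => -[k1 k2] _ /=.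
      by rewrite /F -!LambdaE.
    rewrite (bigD1 nu) //= [X in _ + X]big1 ?addr0 => [|k1 nk]; last first.
      by apply: big1 => k2 _; rewrite /F eq_sym (negbTE nk) mul0r.
    rewrite /F eqxx; case: (nu == mu); last first.
      by rewrite big1// => k _; rewrite mulr0.
    rewrite (big_morph _ (hD nu) (h0 nu)).
    by apply: eq_bigr => k _; rewrite mul.
- move=> a; apply/matrixP=> p q.
  case: (mxtens_indexP (p : 'I_(l n.+1 * r n)))
      (mxtens_indexP (q : 'I_(l n.+1 * r n))) => nu i [mu j].
  have [_ _ st] := hom nu.
  rewrite [LHS]LambdaE !matalg_star LambdaE eq_sym.
  by case: eqVneq => [->|_]; rewrite ?star0 ?st.
Qed.

End Construction.

(* Main.v *)
From HB Require Import structures.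
Require Import Defs.
From mathcomp Require Import all_boot all_order all_algebra.
From mathcomp Require Import complex mxtens.
From mathcomp Require Import all_classical all_reals topology normedtype realfun.
From mathcomp Require Import ring lra zify.

(** Up to permutation of indices, Lambda_(m,n) is block diagonal with blocks of
    size r(n), some of which are constant: they are the values of the given
    matrix function at projections of the points x_j. By density of these
    projections every nonempty open set of X_n contains a point whose value
    occurs as a constant block, arbitrarily often and in both summands.

    Density of the union of the images in A follows from the universal property,
    since the closure of the union is a C*-algebra through which the cocone
    factors. Moreover |iota_n a| is at most the supremum C of the operator norms
    of the values of a: powers of a^* a reduce this to an entrywise bound.

    Simplicity: a nonzero element of an ideal is close to some iota_n b with
    |<b(y) xi, eta>| large; compressing a constant block near b(y) by constant
    rows and columns gives, up to a small error, a nonzero multiple of the full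
    projection E_11, so E_11, and hence 1, lies in the ideal.

    Stable rank one: if b in A_n is singular at y, then after multiplication by
    constant invertible matrices and a small perturbation b is a diagonal matrix
    with a zero corner, constantly near y. Collecting r(n) constant copies of
    this matrix yields a zero block of size r(n), and a cyclic shift through this
    block makes the remaining blocks nilpotent; hence adding a small multiple of
    a constant matrix makes the image of b invertible.

    Stable finiteness: stable rank one passes to M_k(A) by Schur complements,
    and an isometry close to an invertible element is unitary. *)

Set Implicit Arguments.
Unset Strict Implicit.
Unset Printing Implicit Defensive.

Import Order.TTheory GRing.Theory Num.Theory.
Import numFieldNormedType.Exports.

Local Open Scope classical_set_scope.
Local Open Scope complex_scope.
Local Open Scope ring_scope.

Local Notation nc := Normc.normc.

Lemma nc_ge0 (R : realType) (z : R[i]) : 0 <= nc z.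
Proof. by case: z => a b; exact: sqrtr_ge0. Qed.

Lemma star1 (R : realType) (A : starAlgType R) : star (1 : A) = 1.
Proof. by have := starM (star (1 : A)) 1; rewrite mulr1 starK mulr1. Qed.

Lemma starN (R : realType) (A : starAlgType R) (a : A) : star (- a) = - star a.
Proof. by apply: (addrI (star a)); rewrite -starD !subrr star0. Qed.

(** * Norms in C*-algebras *)

Section CStarBasics.
Variables (R : realType) (A : cstarAlgType R).
Implicit Types a b : A.

Lemma cnorm0 : cnorm (0 : A) = 0.
Proof. by rewrite -(scale0r (0 : A)) cnormZ Normc.normc0 mul0r. Qed.

Lemma cnormN a : cnorm (- a) = cnorm a.
Proof. by rewrite -scaleN1r cnormZ normcN Normc.normc1 mul1r. Qed.

Lemma cnormB a b : cnorm (a - b) <= cnorm a + cnorm b.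
Proof. by rewrite -(cnormN b) cnormD. Qed.

Lemma cnormBC a b : cnorm (a - b) = cnorm (b - a).
Proof. by rewrite -opprB cnormN. Qed.

Lemma cnorm_ge0 a : 0 <= cnorm a.
Proof. by have := cnormB a a; rewrite subrr cnorm0; lra. Qed.

Lemma cnorm_eq0P a : (cnorm a == 0) = (a == 0).
Proof. by apply/eqP/eqP => [/cnorm_eq0|->] //; rewrite cnorm0. Qed.

Lemma cnorm_sum (I : Type) (s : seq I) (P : pred I) (F : I -> A) :
  cnorm (\sum_(i <- s | P i) F i) <= \sum_(i <- s | P i) cnorm (F i).
Proof.
elim/big_ind2 : _ => [|x y x' y' h h'|//]; first by rewrite cnorm0.
by rewrite (le_trans (cnormD _ _))// lerD.
Qed.

Lemma cnorm_starE a : cnorm (star a) = cnorm a.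
Proof.
have le b : cnorm b <= cnorm (star b).
  have := cnorm_star b; have := cnormM (star b) b.
  have := cnorm_ge0 b; have := cnorm_ge0 (star b).
  have [->|n0] := eqVneq (cnorm b) 0; first by [].
  move=> h1 h2 h3 h4; rewrite -(ler_pM2r (_ : 0 < cnorm b)) -?expr2 ?lt0r ?n0//.
  by rewrite -h4.
by apply/eqP; rewrite eq_le le andbT -[leRHS](congr1 cnorm (starK a)) le.
Qed.

Lemma cnorm_proj_le1 a : star a = a -> a * a = a -> cnorm a <= 1.
Proof.
move=> sa aa; have := cnorm_star a; rewrite sa aa.
have := cnorm_ge0 a; nra.
Qed.

Lemma cnorm1 : cnorm (1 : A) = 1.
Proof.
have := cnorm_star (1 : A); rewrite star1 mulr1.
have : cnorm (1 : A) != 0 by rewrite cnorm_eq0P oner_eq0.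
by move=> /mulfI h; rewrite -{1}[cnorm _]mulr1 expr2 => /h.
Qed.

Lemma cnormX n a : (0 < n)%N -> cnorm (a ^+ n) <= cnorm a ^+ n.
Proof.
case: n => // n _; elim: n => [|n IH]; first by rewrite !expr1.
rewrite exprS [leRHS]exprS (le_trans (cnormM _ _))// ler_wpM2l//.
exact: cnorm_ge0.
Qed.

(** Powers of a self-adjoint element are self-adjoint, so the C*-identity squares the norm at each
    doubling of the exponent. *)
Lemma cnorm_selfadjoint_pow k a :
  star a = a -> cnorm (a ^+ (2 ^ k)) = cnorm a ^+ (2 ^ k).
Proof.
move=> sa; have sX n : star (a ^+ n) = a ^+ n.
  elim: n => [|n IH]; first by rewrite star1.
  by rewrite exprSr starM IH sa -exprS exprSr -exprSr exprS.
elim: k => [|k IH]; first by rewrite !expr1.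
by rewrite expnSr !exprM -IH -cnorm_star sX -expr2.
Qed.

End CStarBasics.

(** * Closed *-subalgebras and density in a direct limit *)

Section Subalgebra.
Variables (R : realType) (A : cstarAlgType R).

(** Norm-closedness yields completeness, so the carrier is again a [cstarAlgType] and can be a test
    object in the universal property. *)
Record csubalgebra := CSubalgebra {
  csub_pred :> {pred A};
  csub_closed : subalg_closed csub_pred;
  csub_star : forall a, a \in csub_pred -> star a \in csub_pred;
  csub_norm_closed :
    norm_closure [set a | a \in csub_pred] `<=` [set a | a \in csub_pred] }.

Variable S : csubalgebra.

HB.instance Definition _ :=
  GRing.isSubalgClosed.Build R[i] A (csub_pred S) (csub_closed S).

Definition csub_type := {a : A | a \in csub_pred S}.
HB.instance Definition _ := SubChoice.on csub_type.
HB.instance Definition _ := [SubChoice_isSubAlgebra of csub_type by <:].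
Implicit Types u v : csub_type.

Definition csub_type_star u : csub_type :=
  exist (fun a => a \in csub_pred S) (star (val u)) (csub_star (valP u)).

Lemma csub_starK : involutive csub_type_star.
Proof. by move=> u; apply: val_inj; rewrite /= starK. Qed.
Lemma csub_starD : {morph csub_type_star : u v / u + v}.
Proof. by move=> u v; apply: val_inj; rewrite /= starD. Qed.
Lemma csub_starZ (c : R[i]) u : csub_type_star (c *: u) = c^* *: csub_type_star u.
Proof. by apply: val_inj; rewrite /= starZ. Qed.
Lemma csub_starM u v :
  csub_type_star (u * v) = csub_type_star v * csub_type_star u.
Proof. by apply: val_inj; rewrite /= starM. Qed.

HB.instance Definition _ := isStarAlgebra.Build R csub_type
  csub_starK csub_starD csub_starZ csub_starM.

Definition csub_norm u : R := cnorm (val u).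

Lemma csub_norm_eq0 u : csub_norm u = 0 -> u = 0.
Proof. by move=> /cnorm_eq0 h; apply: val_inj. Qed.
Lemma csub_normD u v : csub_norm (u + v) <= csub_norm u + csub_norm v.
Proof. exact: cnormD. Qed.
Lemma csub_normZ (c : R[i]) u : csub_norm (c *: u) = nc c * csub_norm u.
Proof. exact: cnormZ. Qed.
Lemma csub_normM u v : csub_norm (u * v) <= csub_norm u * csub_norm v.
Proof. exact: cnormM. Qed.
Lemma csub_norm_star u : csub_norm (star u * u) = csub_norm u ^+ 2.
Proof. exact: cnorm_star. Qed.
Lemma csub_norm_complete (u : nat -> csub_type) :
  (forall e : R, 0 < e -> exists N : nat, forall m n : nat,
     (N <= m)%N -> (N <= n)%N -> csub_norm (u m - u n) < e) ->
  exists a : csub_type, csub_norm (u n - a) @[n --> \oo] --> (0 : R).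
Proof.
move=> cauchy; have [a cva] := @cnorm_complete R A (val \o u) cauchy.
have Sa : a \in csub_pred S.
  apply: csub_norm_closed => e e0.
  have /cvgrPdist_lt /(_ e e0) [N _ /(_ N (leqnn N))] := cva.
  rewrite sub0r normrN ger0_norm ?cnorm_ge0// cnormBC => h.
  by exists (val (u N)) => //; exact: valP.
by exists (exist _ a Sa).
Qed.

HB.instance Definition _ := isCStarAlgebra.Build R csub_type
  csub_norm_eq0 csub_normD csub_normZ csub_normM csub_norm_star
  csub_norm_complete.

Lemma csub_val_star_hom : is_star_hom (val : csub_type -> A).
Proof. by split. Qed.

End Subalgebra.

(** * Unital *-homomorphisms *)

Section StarHom.
Variables (R : realType) (A B C : starAlgType R) (f : A -> B) (g : B -> C).
Hypotheses (fh : is_star_hom f) (gh : is_star_hom g).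

Lemma star_homD a b : f (a + b) = f a + f b.
Proof. by case: fh => lin _ _; have := lin 1 a b; rewrite !scale1r. Qed.
Lemma star_hom0 : f 0 = 0.
Proof. by apply: (addrI (f 0)); rewrite -star_homD !addr0. Qed.
Lemma star_homZ c a : f (c *: a) = c *: f a.
Proof. by case: fh => lin _ _; have := lin c a 0; rewrite star_hom0 !addr0. Qed.
Lemma star_homN a : f (- a) = - f a.
Proof. by rewrite -scaleN1r star_homZ scaleN1r. Qed.
Lemma star_homB a b : f (a - b) = f a - f b.
Proof. by rewrite star_homD star_homN. Qed.
Lemma star_homM a b : f (a * b) = f a * f b.
Proof. by case: fh => _ []. Qed.
Lemma star_hom1 : f 1 = 1.
Proof. by case: fh => _ []. Qed.
Lemma star_hom_star a : f (star a) = star (f a).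
Proof. by case: fh. Qed.
Lemma star_homX a n : f (a ^+ n) = f a ^+ n.
Proof.
by elim: n => [|n IH]; rewrite ?star_hom1// !exprS star_homM IH.
Qed.
Lemma star_hom_sum (I : Type) (s : seq I) (P : pred I) (F : I -> A) :
  f (\sum_(i <- s | P i) F i) = \sum_(i <- s | P i) f (F i).
Proof. exact: (big_morph f star_homD star_hom0). Qed.

Lemma star_hom_comp : is_star_hom (g \o f).
Proof.
case: fh gh => [fl [f1 fM] fs] [gl [g1 gM] gs]; split=> [c a b||a] /=.
- by rewrite fl gl.
- by split=> [|a b] /=; rewrite ?f1 ?g1 ?fM ?gM.
- by rewrite fs gs.
Qed.

End StarHom.

Lemma star_hom_id (R : realType) (A : starAlgType R) : is_star_hom (@id A).
Proof. by split. Qed.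

(** * Density of the union of the images *)

Section LimitDensity.
Variables (R : realType) (S : nat -> starAlgType R) (L : forall n, S n -> S n.+1).
Variables (A : cstarAlgType R) (iota : forall n, S n -> A).
Arguments iota : clear implicits.
Hypothesis limA : is_cstar_direct_limit L iota.

Let iota_hom n : is_star_hom (iota n). Proof. by case: limA => -[]. Qed.

Lemma cocone_lift n m (b : S n) : (n <= m)%N -> exists b', iota m b' = iota n b.
Proof.
case: limA => -[_ comm] _ /subnK <-.
by exists (transition L (m - n) b); rewrite comm.
Qed.

Definition limit_image : set A := [set a | exists n b, a = iota n b].

Lemma limit_image_pair a b : limit_image a -> limit_image b ->
  exists n a' b', a = iota n a' /\ b = iota n b'.
Proof.
move=> [n [a' ->]] [m [b' ->]]; exists (maxn n m).
have [a'' <-] := cocone_lift a' (leq_maxl n m).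
have [b'' <-] := cocone_lift b' (leq_maxr n m).
by exists a'', b''.
Qed.

Lemma limit_closure_subalg :
  subalg_closed [pred a | `[< norm_closure limit_image a >]].
Proof.
split=> [|c a b /asboolP ha /asboolP hb|a b /asboolP ha /asboolP hb];
  apply/asboolP => e e0.
- by exists 1; rewrite ?subrr ?cnorm0//; exists 0, 1; rewrite star_hom1.
- have k0 : 0 < nc c + 1 by rewrite ltr_wpDl// nc_ge0.
  have [a' ua' da] := ha _ (divr_gt0 e0 k0).
  have [b' ub' db] := hb _ (divr_gt0 e0 k0).
  have [n [a1 [b1 [ea eb]]]] := limit_image_pair ua' ub'.
  exists (c *: a' + b').
    by exists n, (c *: a1 + b1); rewrite star_homD// star_homZ// ea eb.
  have -> : c *: a + b - (c *: a' + b') = c *: (a - a') + (b - b').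
    by rewrite scalerBr opprD addrACA.
  rewrite (le_lt_trans (cnormD _ _))// cnormZ.
  have -> : e = nc c * (e / (nc c + 1)) + e / (nc c + 1).
    by field; rewrite gt_eqF.
  by rewrite ler_ltD// ler_wpM2l ?nc_ge0// ltW.
- pose K := cnorm a + cnorm b + 1.
  have a0 := cnorm_ge0 a; have b0 := cnorm_ge0 b.
  have k0 : 0 < K by rewrite /K; lra.
  (* The bound 1 keeps [cnorm b'] at most [cnorm b + 1]; the bound [e / K] keeps the total error
     [t * K] at most [e]. *)
  pose t := Num.min 1 (e / K).
  have t0 : 0 < t by rewrite lt_min ltr01 divr_gt0.
  have [a' ua' da] := ha _ t0; have [b' ub' db] := hb _ t0.
  have [n [a1 [b1 [ea eb]]]] := limit_image_pair ua' ub'.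
  exists (a' * b'); first by exists n, (a1 * b1); rewrite star_homM// ea eb.
  have -> : a * b - a' * b' = a * (b - b') + (a - a') * b'.
    by rewrite mulrBr mulrBl addrA subrK.
  have tK : t * K <= e by rewrite -ler_pdivlMr// ge_min lexx orbT.
  have t1 : t <= 1 by rewrite ge_min lexx.
  have b'K : cnorm b' <= cnorm b + 1.
    have -> : b' = b - (b - b') by rewrite opprB addrC subrK.
    by rewrite (le_trans (cnormB _ _))// lerD2l ltW// (lt_le_trans db).
  rewrite (le_lt_trans (cnormD _ _))//.
  rewrite (le_lt_trans (lerD (cnormM _ _) (cnormM _ _)))//.
  have := cnorm_ge0 b'; have := cnorm_ge0 (a - a'); have := cnorm_ge0 (b - b').
  move: da db tK b'K; rewrite /K; nra.
Qed.

Lemma limit_closure_star a : a \in [pred a | `[< norm_closure limit_image a >]] ->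
  star a \in [pred a | `[< norm_closure limit_image a >]].
Proof.
move=> /asboolP ha; apply/asboolP => e e0.
have [b [n [b' ->]] ab] := ha _ e0.
exists (iota n (star b')); first by exists n, (star b').
have -> : star a - iota n (star b') = star (a - iota n b').
  by rewrite star_hom_star// starD starN.
by rewrite cnorm_starE.
Qed.

Lemma limit_closure_closed :
  norm_closure [set a | a \in [pred a | `[< norm_closure limit_image a >]]]
  `<=` [set a | a \in [pred a | `[< norm_closure limit_image a >]]].
Proof.
move=> a ha; apply/asboolP => e e0.
have e20 : 0 < e / 2 by rewrite divr_gt0.
have [b /asboolP hb ab] := ha _ e20; have [c uc bc] := hb _ e20.
exists c => //; have -> : a - c = (a - b) + (b - c) by rewrite addrA subrK.
by rewrite (le_lt_trans (cnormD _ _))//; lra.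
Qed.

Definition limit_closure : csubalgebra A :=
  CSubalgebra limit_closure_subalg limit_closure_star limit_closure_closed.

(* The closure B of the union of the images is itself a cocone, so there is a
   unital *-homomorphism A -> B; composed with the inclusion of B it fixes all
   images, hence it is the identity by uniqueness, and B = A. *)
Lemma limit_image_dense a : norm_closure limit_image a.
Proof.
have memB n b : iota n b \in csub_pred limit_closure.
  by apply/asboolP => e e0; exists (iota n b); [exists n, b|rewrite subrr cnorm0].
pose psi n (b : S n) : csub_type limit_closure := exist _ (iota n b) (memB n b).
have psi_cocone : is_cocone L psi.
  split=> [n|n k b]; last by apply: val_inj; case: limA => -[_ h] _; exact: h.
  split=> [c b b'||b].
  - by apply: val_inj; rewrite /= star_homD// star_homZ.
  - by split=> [|b b']; apply: val_inj; rewrite /= ?star_hom1 ?star_homM.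
  - by apply: val_inj; rewrite /= star_hom_star.
case: limA => co univ; have [phi [[phi_hom phiE] _]] := univ _ _ psi_cocone.
have [z [_ uniq]] := univ A iota co.
have zid : z = id := uniq id (conj (star_hom_id A) (fun n b => erefl)).
have zphi : z = val \o phi.
  apply: uniq; split=> [|n b /=]; last by rewrite phiE.
  exact: star_hom_comp phi_hom (csub_val_star_hom _).
have -> : a = val (phi a) by rewrite -[LHS]/(id a) -zid zphi.
by apply/asboolP; exact: valP (phi a).
Qed.

End LimitDensity.

(** * Pointwise evaluation in A_n *)

Section Evaluation.
Variable R : realType.

(** Commutativity makes determinants and adjugates available for matrices over [C2]. *)
Lemma cfun_mulC (T : ptopologicalType) : commutative (@cfun_mul R T).
Proof. by move=> f g; apply: cfunP => x; exact: mulrC. Qed.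
HB.instance Definition _ (T : ptopologicalType) :=
  GRing.PzRing_hasCommutativeMul.Build (cfun R T) (@cfun_mulC T).

Definition comp2 n (c : bool) (f : C2 R n) : cfun R (X R n) :=
  if c then f.1 else f.2.

Definition ev n (c : bool) (z : X R n) (f : C2 R n) : R[i] :=
  cfun_eval (comp2 c f) z.

Lemma ev_is_zmod n c (z : X R n) : zmod_morphism (ev c z).
Proof. by case: c => f g. Qed.
Lemma ev_is_monoid n c (z : X R n) : monoid_morphism (ev c z).
Proof. by case: c; split. Qed.
HB.instance Definition _ n c (z : X R n) :=
  GRing.isZmodMorphism.Build (C2 R n) R[i] (ev c z) (ev_is_zmod c z).
HB.instance Definition _ n c (z : X R n) :=
  GRing.isMonoidMorphism.Build (C2 R n) R[i] (ev c z) (ev_is_monoid c z).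

Lemma ev_star n c (z : X R n) f : ev c z (star f) = (ev c z f)^*.
Proof. by case: c. Qed.

Lemma evD n c (z : X R n) (f g : C2 R n) : ev c z (f + g) = ev c z f + ev c z g.
Proof. exact: rmorphD. Qed.
Lemma evB n c (z : X R n) (f g : C2 R n) : ev c z (f - g) = ev c z f - ev c z g.
Proof. exact: rmorphB. Qed.
Lemma evM n c (z : X R n) (f g : C2 R n) : ev c z (f * g) = ev c z f * ev c z g.
Proof. exact: rmorphM. Qed.
Lemma ev1 n c (z : X R n) : ev c z 1 = 1.
Proof. exact: rmorph1. Qed.

Lemma evZ n c (z : X R n) k f : ev c z (k *: f) = k * ev c z f.
Proof. by case: c. Qed.

Lemma ev_inj n (f g : C2 R n) : (forall c z, ev c z f = ev c z g) -> f = g.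
Proof.
case: f g => [f1 f2] [g1 g2] h; congr pair; apply: cfunP => z.
  exact: (h true z).
exact: (h false z).
Qed.

Lemma ev_continuous n c (f : C2 R n) :
  continuous (fun z : X R n => ev c z f : R[i]^o).
Proof. by move=> z; exact: cfun_continuous. Qed.

Definition cst2 n (k : bool -> R[i]) : C2 R n :=
  (cfun_cst _ (k true), cfun_cst _ (k false)).

Lemma ev_cst2 n k c (z : X R n) : ev c z (cst2 n k) = k c.
Proof. by case: c. Qed.

Definition map2 n (h : R[i]^o -> R[i]^o) (ch : continuous h) (f : C2 R n) : C2 R n :=
  (mkcfun (fun z => continuous_comp (@cfun_continuous _ _ f.1 z) (ch _)),
   mkcfun (fun z => continuous_comp (@cfun_continuous _ _ f.2 z) (ch _))).

Lemma ev_map2 n h (ch : continuous h) c (z : X R n) f :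
  ev c z (map2 ch f) = h (ev c z f).
Proof. by case: c. Qed.

Lemma ev_inv_continuous n c (f : C2 R n) : (forall z, ev c z f != 0) ->
  continuous (fun z : X R n => (ev c z f)^-1 : R[i]^o).
Proof.
move=> f0 z; apply: (@continuousV _ _ (fun z => ev c z f : R[i]^o)) => //.
exact: ev_continuous.
Qed.

Lemma C2_inverse n (f : C2 R n) : (forall c z, ev c z f != 0) ->
  exists g, f * g = 1.
Proof.
move=> f0.
exists (mkcfun (ev_inv_continuous (f0 true)), mkcfun (ev_inv_continuous (f0 false))).
by apply: ev_inj => -[] z; exact: mulfV (f0 _ z).
Qed.

Implicit Types n : nat.

Definition mev n (c : bool) (z : X R n) (a : Aalg R n) : 'M[R[i]]_(r n) :=
  map_mx (ev c z) a.

Lemma mevM n c (z : X R n) a b : mev c z (a * b) = mev c z a *m mev c z b.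
Proof. exact: map_mxM. Qed.
Lemma mevD n c (z : X R n) a b : mev c z (a + b) = mev c z a + mev c z b.
Proof. exact: map_mxD. Qed.
Lemma mevB n c (z : X R n) a b : mev c z (a - b) = mev c z a - mev c z b.
Proof. exact: map_mxB. Qed.
Lemma mev1 n c (z : X R n) : mev c z 1 = 1%:M.
Proof. exact: map_mx1. Qed.
Lemma mevZ n c (z : X R n) k a : mev c z (k *: a) = k *: mev c z a.
Proof. by apply/matrixP => i j; rewrite !mxE evZ. Qed.
Lemma mev_star n c (z : X R n) a : mev c z (star a) = (map_mx conjc (mev c z a))^T.
Proof. by apply/matrixP => i j; rewrite !mxE ev_star. Qed.

Lemma mev_inj n (a b : Aalg R n) : (forall c z, mev c z a = mev c z b) -> a = b.
Proof.
move=> h; apply/matrixP => i j; apply: ev_inj => c z.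
by have /matrixP /(_ i j) := h c z; rewrite !mxE.
Qed.

Definition cmx n (F : bool -> 'M[R[i]]_(r n)) : Aalg R n :=
  \matrix_(i, j) cst2 n (fun c => F c i j).

Lemma mev_cmx n F c (z : X R n) : mev c z (cmx F) = F c.
Proof. by apply/matrixP => i j; rewrite !mxE ev_cst2. Qed.

(** The determinant is a nowhere vanishing element of the commutative ring [C2], hence a unit; the
    adjugate divided by it is the inverse. *)
Lemma Aalg_inverse n (a : Aalg R n) : (forall c z, \det (mev c z a) != 0) ->
  exists b, a * b = 1 /\ b * a = 1.
Proof.
move=> h; pose a' : 'M[C2 R n]_(r n) := a.
have [g Dg] : exists g, \det a' * g = 1.
  by apply: C2_inverse => c z; have := h c z; rewrite /mev det_map_mx.
exists (g *: \adj a'); split.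
  by rewrite -[LHS]scalemxAr mul_mx_adj scale_scalar_mx mulrC Dg.
by rewrite -[LHS]scalemxAl mul_adj_mx scale_scalar_mx mulrC Dg.
Qed.

End Evaluation.

(** * Bounds for *-homomorphisms out of A_n *)

Section ComplexContinuity.
Variable R : realType.
Local Notation C := (R[i]^o : normedModType R[i]).
Implicit Types z w : R[i].

Lemma normr_nc z : `|z| = (nc z)%:C.
Proof. by rewrite normc_def; case: z. Qed.

Lemma nc_real (a : R) : nc a%:C = `|a|.
Proof. by rewrite /= expr0n addr0 sqrtr_sqr. Qed.

Lemma nc_eq0 z : (nc z == 0) = (z == 0).
Proof. by apply/eqP/eqP => [/Normc.eq0_normc //|->]; exact: Normc.normc0. Qed.

Lemma sqr_nc z : (nc z ^+ 2)%:C = z * z^*.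
Proof. by rewrite rmorphXn /= -normr_nc sqr_normc. Qed.

Lemma Re_le_nc z : `|complex.Re z| <= nc z.
Proof.
case: z => a b /=; rewrite -(ler_pXn2r (n := 2))// ?nnegrE ?sqrtr_ge0//.
by rewrite sqr_sqrtr ?addr_ge0 ?sqr_ge0// real_normK ?num_real// lerDl sqr_ge0.
Qed.

Lemma Im_le_nc z : `|complex.Im z| <= nc z.
Proof.
case: z => a b /=; rewrite -(ler_pXn2r (n := 2))// ?nnegrE ?sqrtr_ge0//.
by rewrite sqr_sqrtr ?addr_ge0 ?sqr_ge0// real_normK ?num_real// lerDr sqr_ge0.
Qed.

Lemma nc_le_ReIm z : nc z <= `|complex.Re z| + `|complex.Im z|.
Proof.
rewrite {1}[z]complexE (le_trans (le_normcD _ _))// Normc.normcM !nc_real.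
by rewrite [nc 'i]/= expr0n expr1n add0r sqrtr1 mul1r.
Qed.

Lemma near_nc z (e : R) : 0 < e -> nbhs (z : R[i]^o) [set w | nc (z - w) < e].
Proof.
move=> e0; have Fz := nbhs_filter (z : R[i]^o).
have e0' : 0 < e%:C :> R[i] by rewrite ltcR.
have h := @cvgr_dist_lt _ C _ _ Fz id z (fun U => id) _ e0'.
by apply: filterS h => w; rewrite normr_nc ltcR.
Qed.

Lemma Re_continuous : continuous (fun z : R[i]^o => complex.Re z : R).
Proof.
move=> z; have Fz := nbhs_filter (z : R[i]^o).
apply/(@cvgrPdist_lt _ _ _ _ (fmap_filter _ Fz)) => e /(near_nc z).
apply: filterS => w.
by apply: le_lt_trans; have := Re_le_nc (z - w); move: z w {Fz} => [a b] [].
Qed.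

Lemma Im_continuous : continuous (fun z : R[i]^o => complex.Im z : R).
Proof.
move=> z; have Fz := nbhs_filter (z : R[i]^o).
apply/(@cvgrPdist_lt _ _ _ _ (fmap_filter _ Fz)) => e /(near_nc z).
apply: filterS => w.
by apply: le_lt_trans; have := Im_le_nc (z - w); move: z w {Fz} => [a b] [].
Qed.

Lemma cplx_continuous (T : topologicalType) (f g : T -> R) :
  continuous f -> continuous g -> continuous (fun t => f t +i* g t : R[i]^o).
Proof.
move=> cf cg t; have Ft := nbhs_filter t.
apply/(@cvgrPdist_lt _ C _ _ (fmap_filter _ Ft)) => e.
rewrite ltcE /= => /andP[/eqP e1 e0].
have e20 : 0 < complex.Re e / 2 by rewrite divr_gt0.
have /cvgrPdist_lt /(_ _ e20) h1 := cf t.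
have /cvgrPdist_lt /(_ _ e20) h2 := cg t.
near=> u; have h : nc ((f t +i* g t) - (f u +i* g u)) < complex.Re e.
  rewrite (le_lt_trans (nc_le_ReIm _))//= [ltRHS]splitr ltrD//.
    by near: u.
  by near: u.
have ee : e = (complex.Re e)%:C by apply/eqP; rewrite eq_complex /= -e1 !eqxx.
by rewrite normr_nc [ltRHS]ee ltcR.
Unshelve. all: by end_near. Qed.

End ComplexContinuity.

(** * Crude entrywise norm bounds *)

Section NormBounds.
Variable R : realType.

Lemma unitary_part_continuous (g : R[i]^o -> R) (M : R) : continuous g ->
  continuous (fun z : R[i]^o => g z +i* Num.sqrt (M ^+ 2 - g z ^+ 2) : R[i]^o).
Proof.
move=> cg; apply: cplx_continuous => // z.
apply: (@continuous_comp _ _ _ (fun z => M ^+ 2 - g z ^+ 2) Num.sqrt); last first.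
  exact: sqrt_continuous.
apply: continuousB; first exact: cst_continuous.
apply: (@continuous_comp _ _ _ g (fun x => x ^+ 2)); first exact: cg.
exact: exprn_continuous.
Qed.

(* A real function g with |g| <= M is the mean of u and its adjoint, where
   u = g + i sqrt(M^2 - g^2) satisfies u^* u = M^2; so a *-homomorphism can be
   bounded without spectral theory. *)
Lemma star_hom_real_bound n (A : cstarAlgType R) (phi : C2 R n -> A)
    (g : R[i]^o -> R) (cg : continuous g) (f h : C2 R n) (M : R) :
  is_star_hom phi -> 0 <= M ->
  (forall c z, `|g (ev c z f)| <= M) ->
  (forall c z, ev c z h = (g (ev c z f))%:C) ->
  cnorm (phi h) <= M.
Proof.
move=> hom M0 gM hE.
pose u := map2 (unitary_part_continuous (M := M) cg) f.
have uu : star u * u = (M ^+ 2)%:C *: 1.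
  apply: ev_inj => c z; rewrite evM ev_star ev_map2 evZ ev1 mulr1.
  rewrite mulrC -sqr_nc; congr (_%:C).
  rewrite /= sqr_sqrtr ?addr_ge0 ?sqr_ge0// sqr_sqrtr; first by ring.
  rewrite subr_ge0 -[leLHS]real_normK ?num_real//.
  by rewrite ler_pXn2r ?nnegrE.
have uh : h = (2^-1)%:C *: (u + star u).
  apply: ev_inj => c z; rewrite evZ evD ev_star ev_map2 hE.
  by apply/eqP; rewrite eq_complex /=; apply/andP; split; apply/eqP; field.
have nu : cnorm (phi u) = M.
  have := cnorm_star (phi u); rewrite -star_hom_star// -star_homM// uu.
  rewrite star_homZ// star_hom1// cnormZ cnorm1 mulr1 nc_real.
  rewrite ger0_norm ?sqr_ge0// => /eqP.
  by rewrite eqrXn2 ?cnorm_ge0// => /eqP.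
rewrite uh star_homZ// star_homD// star_hom_star// cnormZ nc_real.
have := cnormD (phi u) (star (phi u)); rewrite cnorm_starE nu.
by rewrite ger0_norm ?invr_ge0//; lra.
Qed.

(** The factor 2 comes from bounding real and imaginary parts separately; [star_hom_form_bound]
    later absorbs it. *)
Lemma star_hom_bound n (A : cstarAlgType R) (phi : C2 R n -> A) (f : C2 R n) (M : R) :
  is_star_hom phi -> 0 <= M -> (forall c z, nc (ev c z f) <= M) ->
  cnorm (phi f) <= 2 * M.
Proof.
move=> hom M0 fM.
have c0 : continuous (fun _ : R[i]^o => 0 : R) by exact: cst_continuous.
have cre : continuous (fun z : R[i]^o => complex.Re z +i* 0 : R[i]^o).
  exact: cplx_continuous (@Re_continuous R) c0.
have cim : continuous (fun z : R[i]^o => complex.Im z +i* 0 : R[i]^o).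
  exact: cplx_continuous (@Im_continuous R) c0.
have -> : f = map2 cre f + 'i *: map2 cim f.
  by apply: ev_inj => c z; rewrite evD evZ !ev_map2 [LHS]complexE.
rewrite star_homD// star_homZ// (le_trans (cnormD _ _))// cnormZ.
rewrite [nc 'i]/= expr0n expr1n add0r sqrtr1 mul1r mulr2n mulrDl !mul1r lerD//.
  apply: (star_hom_real_bound (@Re_continuous R) (f := f)) => // c z.
    exact: le_trans (Re_le_nc _) (fM c z).
  by rewrite ev_map2.
apply: (star_hom_real_bound (@Im_continuous R) (f := f)) => // c z.
  exact: le_trans (Im_le_nc _) (fM c z).
by rewrite ev_map2.
Qed.

Lemma delta_mx_star n (i j : 'I_(r n)) :
  star (delta_mx i j : Aalg R n) = delta_mx j i.
Proof.
apply/matrixP => k l; rewrite matalg_star !mxE andbC.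
by case: (_ && _); rewrite ?star1 ?star0.
Qed.

Lemma delta_mxM n (i j k : 'I_(r n)) :
  (delta_mx i j : Aalg R n) * (delta_mx j k : Aalg R n) = delta_mx i k.
Proof. exact: mul_delta_mx. Qed.

(** By the C*-identity, since E_ij^* E_ij = E_jj is a projection. *)
Lemma delta_mx_norm n (A : cstarAlgType R) (phi : Aalg R n -> A) i j :
  is_star_hom phi -> cnorm (phi (delta_mx i j)) <= 1.
Proof.
move=> hom; have := cnorm_star (phi (delta_mx i j)).
rewrite -(star_hom_star hom) -(star_homM hom) delta_mx_star delta_mxM.
have : cnorm (phi (delta_mx j j)) <= 1.
  apply: cnorm_proj_le1; first by rewrite -(star_hom_star hom) delta_mx_star.
  by rewrite -(star_homM hom) delta_mxM.
have := cnorm_ge0 (phi (delta_mx i j)); nra.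
Qed.

Lemma scalar_star_hom n : is_star_hom (fun f : C2 R n => f%:M : Aalg R n).
Proof.
split=> [c f g||f].
- apply/matrixP => i j; rewrite matalgD matalgZ !mxE.
  by case: (i == j); rewrite ?mulr1n ?mulr0n// scaler0 addr0.
- by split=> // f g; exact: scalar_mxM.
- apply/matrixP => i j; rewrite matalg_star !mxE [j == i]eq_sym.
  by case: (i == j); rewrite ?mulr1n ?mulr0n// star0.
Qed.

Lemma entry_bound n (A : cstarAlgType R) (phi : Aalg R n -> A) (a : Aalg R n) (M : R) :
  is_star_hom phi -> 0 <= M -> (forall c z i j, nc (mev c z a i j) <= M) ->
  cnorm (phi a) <= (r n)%:R ^+ 2 * (2 * M).
Proof.
move=> hom M0 aM.
have -> : a = \sum_i \sum_j ((a i j)%:M : Aalg R n) * (delta_mx i j : Aalg R n).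
  rewrite [LHS]matrix_sum_delta; apply: eq_bigr => i _; apply: eq_bigr => j _.
  exact/esym/mul_scalar_mx.
rewrite star_hom_sum//.
have b1 i j :
    cnorm (phi (((a i j)%:M : Aalg R n) * (delta_mx i j : Aalg R n))) <= 2 * M.
  rewrite star_homM// (le_trans (cnormM _ _))// -[leRHS]mulr1.
  rewrite ler_pM ?cnorm_ge0//; last exact: delta_mx_norm.
  apply: (@star_hom_bound _ _ (phi \o (fun f : C2 R n => f%:M : Aalg R n))) => //.
    exact: star_hom_comp (scalar_star_hom n) hom.
  by move=> c z; have := aM c z i j; rewrite mxE.
rewrite (le_trans (cnorm_sum _ _ _))//.
have -> : (r n)%:R ^+ 2 * (2 * M) = \sum_(i < r n) \sum_(j < r n) (2 * M).
  by rewrite !sumr_const !card_ord -mulrnA -[RHS]mulr_natl natrM expr2.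
apply: ler_sum => i _; rewrite star_hom_sum//.
by rewrite (le_trans (cnorm_sum _ _ _))//; exact: ler_sum.
Qed.

End NormBounds.

(** * From sesquilinear forms to sharp norm bounds *)

Section OperatorBounds.
Variable R : realType.

Definition adjmx m n (M : 'M[R[i]]_(m, n)) : 'M[R[i]]_(n, m) := (map_mx conjc M)^T.

Lemma adjmxM m n p (M : 'M[R[i]]_(m, n)) (N : 'M[R[i]]_(n, p)) :
  adjmx (M *m N) = adjmx N *m adjmx M.
Proof. by rewrite /adjmx map_mxM trmx_mul. Qed.

Lemma adjmxK m n (M : 'M[R[i]]_(m, n)) : adjmx (adjmx M) = M.
Proof. by apply/matrixP => i j; rewrite !mxE conjcK. Qed.

Definition nsq q (v : 'cV[R[i]]_q) : R := \sum_i nc (v i 0) ^+ 2.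

Lemma nsq_ge0 q (v : 'cV[R[i]]_q) : 0 <= nsq v.
Proof. by apply: sumr_ge0 => i _; exact: sqr_ge0. Qed.

Lemma nsqE q (v : 'cV[R[i]]_q) : (adjmx v *m v) 0 0 = (nsq v)%:C.
Proof.
rewrite mxE /nsq rmorph_sum; apply: eq_bigr => i _.
by rewrite [RHS]sqr_nc !mxE mulrC.
Qed.

Definition form q (eta : 'cV[R[i]]_q) (M : 'M_q) (xi : 'cV[R[i]]_q) : R[i] :=
  (adjmx eta *m M *m xi) 0 0.

(** [K] bounds the square of the operator norm. *)
Definition op_bound q (K : R) (M : 'M[R[i]]_q) :=
  forall xi, nsq (M *m xi) <= K * nsq xi.

Lemma op_boundM q K L (M N : 'M[R[i]]_q) : 0 <= K ->
  op_bound K M -> op_bound L N -> op_bound (K * L) (M *m N).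
Proof.
move=> K0 hM hN xi; rewrite -mulmxA (le_trans (hM _))// -mulrA.
by rewrite ler_wpM2l.
Qed.

Lemma op_bound_entry q K (M : 'M[R[i]]_q) i j : op_bound K M -> nc (M i j) ^+ 2 <= K.
Proof.
move=> /(_ (delta_mx j 0)); rewrite -colE /nsq.
have -> : \sum_k nc ((delta_mx j 0 : 'cV[R[i]]_q) k 0) ^+ 2 = 1.
  rewrite (bigD1 j)//= mxE !eqxx Normc.normc1 expr1n big1 ?addr0// => k kj.
  by rewrite mxE (negbTE kj) Normc.normc0 expr0n.
rewrite mulr1; apply: le_trans; rewrite (bigD1 i)//= mxE lerDl.
by apply: sumr_ge0 => k _; exact: sqr_ge0.
Qed.

(** Testing the form on the pair [M *m xi], [xi] gives |M xi|^4 <= K |M xi|^2 |xi|^2, and one factor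
    cancels; the pair [xi], [adjmx M *m xi] handles the adjoint. *)
Lemma form_bound_op q K (M : 'M[R[i]]_q) : 0 <= K ->
  (forall eta xi, nc (form eta M xi) ^+ 2 <= K * nsq eta * nsq xi) ->
  op_bound K M /\ op_bound K (adjmx M).
Proof.
move=> K0 h; have le x y : 0 <= x -> 0 <= y -> x ^+ 2 <= K * x * y -> x <= K * y.
  move=> x0 y0; have [->|xn0] := eqVneq x 0; first by rewrite mulr_ge0.
  by rewrite expr2 mulrAC ler_pM2r// lt0r xn0.
split=> xi; apply: le; rewrite ?nsq_ge0//.
  have := h (M *m xi) xi; rewrite /form -mulmxA nsqE nc_real.
  by rewrite ger0_norm// nsq_ge0.
have := h xi (adjmx M *m xi).
rewrite /form -[adjmx xi *m M]adjmxK adjmxM adjmxK nsqE.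
by rewrite nc_real ger0_norm ?nsq_ge0// mulrAC.
Qed.

Lemma bernoulli (t : R) n : 0 <= t -> 1 + n%:R * t <= (1 + t) ^+ n.
Proof.
move=> t0; elim: n => [|n IH]; first by rewrite mul0r addr0 expr0.
have n0 : 0 <= n%:R :> R by [].
rewrite exprS -natr1; apply: le_trans (ler_wpM2l _ IH); nra.
Qed.

(** If x > y, the powers of x / y exceed any constant by Bernoulli's inequality. *)
Lemma le_of_pow2_le (D x y : R) : 0 <= x -> 0 < y ->
  (forall k, x ^+ (2 ^ k) <= D * y ^+ (2 ^ k)) -> x <= y.
Proof.
move=> x0 y0 h; rewrite leNgt; apply/negP => yx.
pose t := x / y - 1.
have t0 : 0 < t by rewrite subr_gt0 ltr_pdivlMr// mul1r.
have bd k : 1 + (2 ^ k)%:R * t <= D.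
  rewrite (le_trans (bernoulli _ (ltW t0)))// /t addrC subrK expr_div_n.
  by rewrite ler_pdivrMr ?exprn_gt0.
have := bd (Num.bound (D / t)).
have Dt : D / t < (2 ^ Num.bound (D / t))%:R.
  case: (lerP 0 (D / t)) => [D0|]; last by move=> /lt_le_trans; apply.
  by rewrite (lt_trans (archi_boundP D0))// ltr_nat ltn_expl.
by rewrite ltr_pdivrMr// in Dt; lra.
Qed.

(* Powers of h = a^* a turn the crude entrywise bound, whose constant depends
   on the matrix size, into the sharp one. *)
Lemma star_hom_form_bound n (A : cstarAlgType R) (phi : Aalg R n -> A)
    (a : Aalg R n) (C : R) : is_star_hom phi -> 0 < C ->
  (forall c z eta xi,
     nc (form eta (mev c z a) xi) ^+ 2 <= C ^+ 2 * nsq eta * nsq xi) ->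
  cnorm (phi a) <= C.
Proof.
move=> hom C0 ha; pose h := star a * a.
have C20 : 0 <= C ^+ 2 by rewrite sqr_ge0.
(* Each of [a] and [star a] contributes a squared norm bound [C ^+ 2] to [h]. *)
have hop N c z : op_bound ((C ^+ 2 * C ^+ 2) ^+ N) (mev c z (h ^+ N)).
  have [h1 h2] := form_bound_op C20 (ha c z).
  elim: N => [|N IH]; first by move=> xi; rewrite mev1 mul1mx mul1r.
  rewrite [(_ * _) ^+ _]exprS [h ^+ _]exprS mevM; apply: op_boundM => //.
    exact: mulr_ge0.
  by rewrite mevM mev_star; exact: op_boundM.
have hN N : cnorm (phi (h ^+ N)) <= (r n)%:R ^+ 2 * (2 * (C ^+ 2) ^+ N).
  apply: entry_bound => //; first by rewrite exprn_ge0.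
  move=> c z i j; have CN : 0 <= (C ^+ 2) ^+ N by rewrite exprn_ge0.
  rewrite -(ler_pXn2r (n := 2)) ?nnegrE ?nc_ge0//.
  rewrite (le_trans (op_bound_entry i j (hop N c z)))//.
  by rewrite exprMn [leRHS]expr2.
have hs : star (phi h) = phi h by rewrite -(star_hom_star hom) starM starK.
have : cnorm (phi h) <= C ^+ 2.
  apply: (@le_of_pow2_le ((r n)%:R ^+ 2 * 2)); rewrite ?cnorm_ge0 ?exprn_gt0//.
  by move=> k; rewrite -cnorm_selfadjoint_pow// -(star_homX hom) -mulrA.
rewrite (star_homM hom) (star_hom_star hom) cnorm_star.
by rewrite ler_pXn2r ?nnegrE ?cnorm_ge0 ?(ltW C0).
Qed.

End OperatorBounds.

(** * Constant blocks of the connecting maps *)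

Section Words.
Variables (R : realType) (x : forall m, X R m).
Arguments x : clear implicits.

Lemma d_le_l n : (d n <= l n)%N.
Proof. exact: leq_subr. Qed.

Definition path_index n (j : 'I_(d n)) : 'I_(l n) := widen_ord (d_le_l n) j.

Lemma d_lt_l n : (d n < l n)%N.
Proof. by rewrite /d /l subn1 ltn_predL expn_gt0. Qed.

(** The last of the l(n) = d(n) + 1 diagonal positions carries the point evaluation, which
    interchanges the summands; hence [~~ c] below. *)
Definition point_index n : 'I_(l n) := Ordinal (d_lt_l n).

Lemma ev_lambda_path n (j : 'I_(d n.+1)) f c (z : X R n.+1) :
  ev c z (lambda_entry x (path_index j) f) = ev c (P R j z) f.
Proof.
rewrite /lambda_entry; case: insubP => [j' _ jj'|]; last by rewrite (ltn_ord j).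
by have -> : j' = j; [exact: val_inj|case: c].
Qed.

Lemma ev_lambda_point n f c (z : X R n.+1) :
  ev c z (lambda_entry x (point_index n.+1) f) = ev (~~ c) (x n) f.
Proof. by rewrite /lambda_entry; case: insubP => [j|_]; [rewrite ltnn|case: c]. Qed.

(* Lambda_(k+n,n) is block diagonal, with blocks indexed by words of length k
   that record which diagonal entry is taken at each stage. *)
Fixpoint word (n k : nat) : finType :=
  if k is k'.+1 then ('I_(l (k' + n).+1) * word n k')%type else unit.

Fixpoint widx n k : word n k * 'I_(r n) -> 'I_(r (k + n)) :=
  match k return word n k * 'I_(r n) -> 'I_(r (k + n)) with
  | 0 => fun p => p.2
  | k'.+1 => fun p => mxtens_index (p.1.1, widx (p.1.2, p.2))
  end.

Fixpoint wunidx n k : 'I_(r (k + n)) -> word n k * 'I_(r n) :=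
  match k return 'I_(r (k + n)) -> word n k * 'I_(r n) with
  | 0 => fun i => (tt, i)
  | k'.+1 => fun i =>
      let p := mxtens_unindex (i : 'I_(l (k' + n).+1 * r (k' + n))) in
      let q := @wunidx n k' p.2 in ((p.1, q.1), q.2)
  end.

Lemma widxK n k : cancel (@widx n k) (@wunidx n k).
Proof.
elim: k => [[[] i] //|k IH [[nu w] i]].
transitivity (let p := mxtens_unindex (mxtens_index (nu, widx (w, i))) in
  (p.1, (wunidx p.2).1, (wunidx p.2).2)); first by [].
by rewrite mxtens_indexK [LHS]/= IH.
Qed.

Lemma wunidxK n k : cancel (@wunidx n k) (@widx n k).
Proof.
elim: k => [i //|k IH i].
pose p := mxtens_unindex (i : 'I_(l (k + n).+1 * r (k + n))).
transitivity (mxtens_index (p.1, widx ((wunidx p.2).1, (wunidx p.2).2))).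
  by [].
by rewrite -surjective_pairing IH -surjective_pairing mxtens_unindexK.
Qed.

(** The map applied to each entry in the block of a word. Projection letters compose with
    projections; one point evaluation makes the result constant on each summand. *)
Fixpoint theta n k : word n k -> C2 R n -> C2 R (k + n) :=
  match k return word n k -> C2 R n -> C2 R (k + n) with
  | 0 => fun _ f => f
  | k'.+1 => fun w f => lambda_entry x w.1 (theta w.2 f)
  end.

Lemma transitionE n k (a : Aalg R n) w i w' j :
  (transition (fun n => @Lambda R x n) k a : 'M_(r (k + n)))
    (widx (w, i)) (widx (w', j)) =
  if w == w' then theta w ((a : 'M_(r n)) i j) else 0.
Proof.
elim: k w w' => [[] [] //|k IH [nu w] [mu w']] /=.
rewrite LambdaE xpair_eqE IH.
case: (nu =P mu) => //= _; case: (w == w') => //.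
by rewrite (star_hom0 (lambda_entry_star_hom x nu)).
Qed.

Definition word_const n (c : bool) (y : X R n) k (c' : bool) (w : word n k) :=
  forall f z, ev c' z (theta w f) = ev c y f.

Lemma word_block n k (a : Aalg R n) c y c' (w : word n k) (z : X R (k + n)) i j :
  word_const c y c' w ->
  mev c' z (transition (fun n => @Lambda R x n) k a) (widx (w, i)) (widx (w, j)) =
  mev c y a i j.
Proof. by move=> wc; rewrite !mxE transitionE eqxx wc. Qed.

(** Each projection [P nu] contributes the letter [path_index nu]. The level [m] equals [k + n] only
    up to [E], hence the transport. *)
Lemma proj_composite_word n m (g : X R m -> X R n) : proj_composite g ->
  exists k (w : word n k) (E : (k + n)%N = m), forall c f (z : X R (k + n)),
    ev c z (theta w f) = ev c (g (eq_rect _ (X R) z _ E)) f.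
Proof.
elim => [|{}m {}g nu _ [k [w [E h]]]]; first by exists 0, tt, erefl.
case: _ / E g nu h => g nu h.
exists k.+1, (path_index nu, w), erefl => c f z.
by rewrite /= ev_lambda_path h.
Qed.

(** Density puts some y = g(x_m) in [U]; the word of g extended by a point evaluation at x_m is
    constant, on the opposite summand. *)
Lemma dense_word_const n (U : set (X R n)) (c : bool) : dense_orbits x ->
  open U -> U !=set0 ->
  exists2 y, U y & exists k (w : word n k), word_const c y (~~ c) w.
Proof.
move=> /(_ n) dx oU U0; have [y [Uy [m [g [pg yE]]]]] := dx U U0 oU.
exists y => //; have [k [w [E h]]] := proj_composite_word pg.
case: _ / E g pg yE h => g pg -> h.
by exists k.+1, (point_index _, w) => f z; rewrite /= ev_lambda_point negbK h.
Qed.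

Lemma d_gt1 m : (1 < d m.+1)%N.
Proof.
have : (2 ^ 2 <= 2 ^ m.+2)%N by rewrite leq_exp2l.
by rewrite /d; lia.
Qed.

(** One more letter, a point evaluation or a projection, reaches both summands at a common length.
    Then two distinct projection letters, available as d >= 2, double the number of words at each
    stage. *)
Lemma word_const_many n (c : bool) (y : X R n) k (w : word n k) N :
  word_const c y (~~ c) w ->
  exists k', forall c', exists s : seq (word n k'),
    [/\ uniq s, size s = N & {in s, forall w', word_const c y c' w'}].
Proof.
(* The strict inequality makes the doubling start from a nonempty list. *)
move=> wc; suff [k' h] : exists k', forall c', exists s : seq (word n k'),
    [/\ uniq s, (N < size s)%N & {in s, forall w', word_const c y c' w'}].
  exists k' => c'; have [s [us Ns hs]] := h c'; exists (take N s).
  split; [exact: take_uniq|by rewrite size_takel// ltnW|].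
  by move=> w' /mem_take; exact: hs.
elim: N => [|N [k' IH]].
  exists k.+1 => c'; exists [:: (if c' == c then point_index _ else
                                   path_index (Ordinal (ltnW (d_gt1 _))), w)].
  split=> // w'; rewrite inE => /eqP -> f z /=.
  have [->|cc] := eqVneq c' c; first by rewrite ev_lambda_point wc.
  by rewrite ev_lambda_path (_ : c' = ~~ c) ?wc//; case: (c) (c') cc => -[].
exists k'.+1 => c'; have [s [us Ns hs]] := IH c'.
pose p0 := path_index (Ordinal (ltnW (d_gt1 (k' + n)))).
pose p1 := path_index (Ordinal (d_gt1 (k' + n))).
exists ([seq (p0, w') | w' <- s] ++ [seq (p1, w') | w' <- s]
  : seq (word n k'.+1)); split.
- rewrite cat_uniq !map_inj_uniq ?us ?andbT /=; try by move=> ? ? [].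
  by apply/hasPn => _ /mapP[w' _ ->]; apply/negP => /mapP[w'' _ []].
- rewrite size_cat !size_map; lia.
- move=> w'; rewrite mem_cat => /orP[] /mapP[v vs ->] f z /=;
  by rewrite ev_lambda_path hs.
Qed.

End Words.

(** * Simplicity *)

Section Corner.
Variable R : realType.

Lemma exp_half_small (e : R) : 0 < e -> exists N, (2^-1 : R) ^+ N.+1 < e.
Proof.
move=> e0; exists (Num.bound e^-1).
have b0 : 0 <= e^-1 by rewrite invr_ge0 ltW.
rewrite exprVn -[ltRHS]invrK ltf_pV2 ?posrE ?invr_gt0 ?exprn_gt0//.
apply: lt_le_trans (archi_boundP b0) _.
have := @bernoulli R 1 (Num.bound e^-1).+1 ler01.
rewrite mulr1 -[1 + 1]/(2%:R) -natr1; lra.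
Qed.

(** With z = e - y one has e z = z and y = e (1 - z), so multiplying [y] by a partial Neumann sum
    gives e - z^(N+1), an element of [I] close to [e]. *)
Lemma ideal_projection (A : cstarAlgType R) (I : set A) (e y : A) :
  norm_closure I `<=` I -> two_sided_ideal I -> e * e = e -> e * y = y ->
  cnorm (e - y) <= 2^-1 -> I y -> I e.
Proof.
move=> clI [_ _ _ _ IM] ee ey small Iy; apply: clI => eps eps0.
have [N hN] := exp_half_small eps0; set z := e - y in small.
exists (y * \sum_(j < N.+1) z ^+ j); first exact: IM.
have ez : e * z = z by rewrite mulrBr ee ey.
have yE : y = e * (1 - z) by rewrite mulrBr mulr1 ez /z opprB addrC subrK.
have geo : (1 - z) * (\sum_(j < N.+1) z ^+ j) = 1 - z ^+ N.+1.
  by rewrite -opprB mulNr -subrX1 opprB.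
rewrite {1}yE -mulrA geo mulrBr mulr1 exprS mulrA ez opprB addrC subrK -exprS.
rewrite (le_lt_trans (cnormX _ _))//; apply: le_lt_trans hN.
by rewrite lerXn2r ?nnegrE ?cnorm_ge0 ?invr_ge0.
Qed.

Definition ord_first n : 'I_(r n) := Ordinal (r_gt0 n).

Definition corner n : Aalg R n := delta_mx (ord_first n) (ord_first n).

Lemma corner_full n :
  \sum_i (delta_mx i (ord_first n) : Aalg R n) * corner n *
         (delta_mx (ord_first n) i : Aalg R n) = 1.
Proof.
transitivity (\sum_i delta_mx i i : 'M[C2 R n]_(r n)).
  by apply: eq_bigr => i _; rewrite /corner !delta_mxM.
exact/esym/mx1_sum_delta.
Qed.

Lemma mev_corner n c (z : X R n) :
  mev c z (corner n) = delta_mx (ord_first n) (ord_first n).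
Proof. exact: map_delta_mx. Qed.

Lemma corner_idem n : corner n * corner n = corner n.
Proof. exact: mul_delta_mx. Qed.

(** A row vector is stored as the first row of a square matrix, so that compressions stay inside
    [Aalg]. *)
Definition corner_row n (v : bool -> 'rV[R[i]]_(r n)) : Aalg R n :=
  cmx (fun c => delta_mx (ord_first n) 0 *m v c).

Definition corner_col n (v : bool -> 'cV[R[i]]_(r n)) : Aalg R n :=
  star (corner_row (fun c => adjmx (v c))).

Lemma mev_corner_col n v c (z : X R n) :
  mev c z (corner_col v) = v c *m delta_mx 0 (ord_first n).
Proof.
rewrite mev_star mev_cmx -/(adjmx _) adjmxM adjmxK; congr (_ *m _).
apply/matrixP => i j; rewrite !mxE andbC.
by case: (_ && _); rewrite ?conjc1 ?conjc0.
Qed.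

(** W W^* is [K] times the projection E_11, and the C*-identity applies. *)
Lemma corner_row_norm n (A : cstarAlgType R) (phi : Aalg R n -> A) v K :
  is_star_hom phi -> (forall c, nsq (adjmx (v c)) = K) ->
  cnorm (phi (corner_row v)) ^+ 2 <= K.
Proof.
move=> hom vK.
have K0 : 0 <= K by rewrite -(vK true) nsq_ge0.
have e : corner_row v * star (corner_row v) = K%:C *: corner n.
  apply: mev_inj => c z.
  rewrite mevM mev_star !mev_cmx mevZ mev_corner -/(adjmx _) adjmxM.
  have -> : adjmx (delta_mx (ord_first n) 0 : 'cV[R[i]]_(r n)) =
      delta_mx 0 (ord_first n).
    apply/matrixP => i j; rewrite !mxE andbC.
    by case: (_ && _); rewrite ?conjc1 ?conjc0.
  rewrite -mulmxA [v c *m _]mulmxA.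
  have -> : v c *m adjmx (v c) = K%:C%:M.
    by rewrite [LHS]mx11_scalar -{1}[v c]adjmxK nsqE vK.
  by rewrite mul_scalar_mx -scalemxAr mul_delta_mx.
rewrite -cnorm_starE -(cnorm_star (star _)) starK.
rewrite -(star_hom_star hom) -(star_homM hom).
rewrite e (star_homZ hom) cnormZ nc_real ger0_norm// -[leRHS]mulr1 ler_wpM2l//.
exact: delta_mx_norm.
Qed.

End Corner.

(** * Compression to constant blocks and fullness of ideals *)

Section Simple.
Variables (R : realType) (x : forall m, X R m).
Arguments x : clear implicits.

Definition select n k (w : word n k) : 'M[R[i]]_(r n, r (k + n)) :=
  \matrix_(i, p) (p == widx (w, i))%:R.

Lemma selectE n k (w : word n k) (M : 'M_(r (k + n))) :
  select w *m M *m (select w)^T = \matrix_(i, j) M (widx (w, i)) (widx (w, j)).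
Proof.
apply/matrixP => i j; rewrite !mxE (bigD1 (widx (w, j)))//= !mxE eqxx mulr1.
rewrite [X in _ + X]big1 ?addr0 => [|p /negbTE pj]; last by rewrite !mxE pj mulr0.
rewrite (bigD1 (widx (w, i)))//= !mxE eqxx mul1r big1 ?addr0// => p /negbTE pi.
by rewrite !mxE pi mul0r.
Qed.

Lemma select_isometry n k (w : word n k) : select w *m (select w)^T = 1%:M.
Proof.
have := selectE w 1%:M; rewrite mulmx1 => ->; apply/matrixP => i j; rewrite !mxE.
by rewrite (can_eq (@widxK n k)) xpair_eqE eqxx.
Qed.

Lemma adjmx_select n k (w : word n k) : adjmx (select w) = (select w)^T.
Proof.
apply/matrixP => i j; rewrite !mxE.
by case: (_ == _); rewrite ?conjc1 ?conjc0.
Qed.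

Lemma nsq_select n k (w : word n k) (v : 'cV[R[i]]_(r n)) :
  nsq ((select w)^T *m v) = nsq v.
Proof.
apply: (@complexI R); rewrite -!nsqE adjmxM -adjmx_select adjmxK adjmx_select.
by rewrite mulmxA -(mulmxA _ (select w)) select_isometry mulmx1.
Qed.

(** Expressing the form as the value of a single element of [C2] gives its continuity in [y]. *)
Lemma form_ev n c (y : X R n) (a : Aalg R n) eta xi :
  form eta (mev c y a) xi =
  ev c y (\sum_i \sum_j cst2 n (fun _ => (eta i 0)^* * xi j 0) * a i j).
Proof.
rewrite /form -mulmxA mxE rmorph_sum; apply: eq_bigr => i _.
rewrite [X in _ * X]mxE rmorph_sum mulr_sumr; apply: eq_bigr => j _ /=.
by rewrite evM ev_cst2 !mxE; ring.
Qed.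

Lemma open_form_gt n c (y : X R n) (a : Aalg R n) eta xi (K : R) :
  K < nc (form eta (mev c y a) xi) ->
  exists U : set (X R n), [/\ open U, U y &
    forall y', U y' -> K < nc (form eta (mev c y' a) xi)].
Proof.
rewrite form_ev; set F := \sum_i _ => KF.
have cF := @ev_continuous R n c F y.
have e0 : 0 < nc (ev c y F) - K by rewrite subr_gt0.
have := cF _ (near_nc _ e0).
rewrite /= nbhsE => -[U [oU Uy] hU]; exists U; split=> // y' /hU /= h.
rewrite form_ev -/F.
have := le_normcD (ev c y F - ev c y' F) (ev c y' F).
by rewrite subrK; lra.
Qed.

Hypothesis x_dense : dense_orbits x.
Variables (A : cstarAlgType R) (iota : forall n, Aalg R n -> A).
Arguments iota : clear implicits.
Hypothesis limA : is_cstar_direct_limit (fun n => @Lambda R x n) iota.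

Lemma limit_simple : simple_algebra A.
Proof.
have hom n : is_star_hom (iota n) by case: limA => -[].
have comm n k (a : Aalg R n) :
    iota (k + n)%N (transition (fun n => @Lambda R x n) k a) = iota n a.
  by case: limA => -[_ h] _; exact: h.
move=> I clI idI; have [I0 ID IZ Il Ir] := idI.
have [I0only|] := pselect (forall a, I a -> a = 0).
  by left; apply/seteqP; split=> [a /I0only|a ->].
move=> /existsNP[a /not_implyP[Ia /eqP a0]]; right.
(* The constant 4 leaves |iota b| > 2 eps after an approximation within eps, so the final relative
   error is at most 1/2. *)
have [eps eps0 epsE] : exists2 eps, 0 < eps & cnorm a = 4 * eps.
  exists (cnorm a / 4); last by field.
  by rewrite divr_gt0// lt0r cnorm_ge0 cnorm_eq0P a0.
have [_ [n [b ->]] ab] := limit_image_dense limA a eps0.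
have bbig : 2 * eps < cnorm (iota n b).
  by have := cnormD (a - iota n b) (iota n b); rewrite subrK epsE; lra.
have : ~ forall c z eta xi,
    nc (form eta (mev c z b) xi) ^+ 2 <= (2 * eps) ^+ 2 * nsq eta * nsq xi.
  move=> h; have := star_hom_form_bound (hom n) (mulr_gt0 (ltr0Sn _ 1) eps0) h.
  by rewrite leNgt bbig.
move=> /existsNP[c /existsNP[y /existsNP[eta /existsNP[xi /negP]]]].
have [q q0 qq] : exists2 q, 0 <= q & q ^+ 2 = nsq eta * nsq xi.
  exists (Num.sqrt (nsq eta * nsq xi)); first exact: sqrtr_ge0.
  by rewrite sqr_sqrtr// mulr_ge0 ?nsq_ge0.
have K0 : 0 <= 2 * eps * q by rewrite !mulr_ge0 ?(ltW eps0).
rewrite -ltNge -mulrA -qq -exprMn ltr_pXn2r ?nnegrE ?nc_ge0// => big.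
have [U [oU Uy hU]] := open_form_gt big.
have [y' Uy' [k0 [w0 wc0]]] := dense_word_const c x_dense oU (ex_intro _ y Uy).
(* One constant block in each summand suffices, but at the same length [k]. *)
have [k hk] := word_const_many 1 wc0.
have [wd wdP] : exists wd : bool -> word n k,
    forall c', word_const x c y' c' (wd c').
  have ex1 c' : exists w : word n k, word_const x c y' c' w.
    have [[|w ?] [_ s1 hs]] := hk c'; first by [].
    by exists w; apply: hs; rewrite inE eqxx.
  have [w1 h1] := ex1 true; have [w2 h2] := ex1 false.
  by exists (fun c' => if c' then w1 else w2); case.
pose t := form eta (mev c y' b) xi.
have tbig : 2 * eps * q < nc t by exact: hU.
pose W : Aalg R (k + n) := corner_row (fun c' => adjmx eta *m select (wd c')).
pose W' : Aalg R (k + n) := corner_col (fun c' => (select (wd c'))^T *m xi).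
pose L := transition (fun n => @Lambda R x n) k.
have WbW : W * L n b * W' = t *: corner R (k + n).
  apply: mev_inj => c' z; rewrite !mevM mev_cmx mev_corner_col mevZ mev_corner.
  have blk : select (wd c') *m mev c' z (L n b) *m (select (wd c'))^T = mev c y' b.
    rewrite selectE; apply/matrixP => i j.
    by rewrite mxE (word_block _ _ _ _ (wdP c')).
  transitivity (delta_mx (ord_first (k + n)) 0 *m (adjmx eta *m
      (select (wd c') *m mev c' z (L n b) *m (select (wd c'))^T) *m xi) *m
      delta_mx 0 (ord_first (k + n)) : 'M[R[i]]_(r (k + n))).
    by rewrite !mulmxA.
  rewrite blk [_ *m xi]mx11_scalar -/t mul_mx_scalar -scalemxAl.
  by rewrite mul_delta_mx.
clearbody t.
have nW : cnorm (iota _ W) ^+ 2 <= nsq eta.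
  apply: corner_row_norm => // c'.
  by rewrite adjmxM adjmxK adjmx_select nsq_select.
have nW' : cnorm (iota _ W') ^+ 2 <= nsq xi.
  rewrite /W' (star_hom_star (hom _)) cnorm_starE.
  by apply: corner_row_norm => // c'; rewrite adjmxK nsq_select.
have t0 : t != 0 by rewrite -nc_eq0 gt_eqF// (le_lt_trans K0).
pose y0 := iota _ W * a * iota _ W'.
pose e := iota _ (corner R (k + n)).
have ee : e * e = e by rewrite -(star_homM (hom _)) corner_idem.
have eW : e * iota _ W = iota _ W.
  rewrite -(star_homM (hom _)); congr (iota _ _).
  apply: mev_inj => c' z; rewrite mevM mev_corner !mev_cmx.
  by rewrite mulmxA mul_delta_mx.
(* Replacing [iota n b] by [a] in the compression costs at most eps * q, while |t| > 2 eps * q; this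
   is the 1/2 of [ideal_projection]. *)
have Ie : I e.
  apply: (@ideal_projection _ _ _ _ (t^-1 *: y0)) => //; last first.
  - exact/IZ/Ir/Il.
  - have -> : e - t^-1 *: y0 = t^-1 *: (iota _ W * (iota n b - a) * iota _ W').
      rewrite mulrBr mulrBl scalerBr -[iota n b](comm n k).
      rewrite -!(star_homM (hom _)) WbW (star_homZ (hom _)).
      by rewrite scalerA mulVf// scale1r.
    rewrite cnormZ Normc.normcV mulrC ler_pdivrMr; last first.
      by rewrite lt0r nc_ge0 nc_eq0 t0.
    have h1 : cnorm (iota _ W * (iota n b - a) * iota _ W') <= eps * q.
      rewrite (le_trans (cnormM _ _))//.
      rewrite (le_trans (ler_wpM2r (cnorm_ge0 _) (cnormM _ _)))//.
      have hq : cnorm (iota _ W) * cnorm (iota _ W') <= q.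
        rewrite -(ler_pXn2r (n := 2)) ?nnegrE ?mulr_ge0 ?cnorm_ge0//.
        by rewrite exprMn qq ler_pM ?sqr_ge0.
      rewrite [cnorm (iota n b - a)]cnormBC mulrAC mulrC.
      by rewrite ler_pM ?mulr_ge0 ?cnorm_ge0 ?(ltW ab).
    by apply: le_trans h1 _; move: tbig; lra.
  - by rewrite -scalerAr /y0 !mulrA eW.
suff I1 : I 1 by apply/seteqP; split=> // u _; rewrite -[u]mulr1; exact: Il.
rewrite -(star_hom1 (hom (k + n)%N)) -corner_full (star_hom_sum (hom _)).
elim/big_rec : _ => // i u _ Iu; apply: ID => //.
by rewrite !(star_homM (hom _)); exact/Ir/Il.
Qed.

End Simple.

(** * Stable rank one *)

Section NilpotentPerturbation.
Variables (F : numFieldType) (W : finType) (q N : nat).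
Variables (phi : W * 'I_q -> 'I_N) (psi : 'I_N -> W * 'I_q).
Hypotheses (phiK : cancel phi psi) (psiK : cancel psi phi).
Variables (s : seq W) (w0 : W) (last : 'I_q).
Hypotheses (s_uniq : uniq s) (s_size : size s = q).

Let bs := [seq w <- enum W | w \notin s].

(* The last coordinates of the q blocks in s form one virtual zero block of
   size q; [chain j] runs through the blocks outside s and ends there. *)
Let chain (j : nat) (i : 'I_q) : W * 'I_q :=
  if (j < size bs)%N then (nth w0 bs j, i) else (nth w0 s i, last).

(** Blocks outside [s] advance along the chain; the last coordinate of the j-th block of [s] returns
    to coordinate j of its start. The other coordinates are fixed. The default in [insubd] never
    occurs for p.1 in [s], as [s] has size q. *)
Let next (p : W * 'I_q) : W * 'I_q :=
  if p.1 \notin s then chain (index p.1 bs).+1 p.2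
  else if p.2 == last then chain 0 (insubd last (index p.1 s)) else p.

Definition chain_mx : 'M[F]_N := \matrix_(a, b) (b == phi (next (psi a)))%:R.

(** A kernel vector is shown to vanish first along the chain, then on the fixed coordinates, where
    the diagonal entry is 0 or 1 plus [t], hence positive. *)
Lemma det_chain_perturbation (M : 'M[F]_N) (rho : nat) (t : F) :
  (rho <= last)%N -> 0 < t ->
  (forall w i w' j, w != w' -> M (phi (w, i)) (phi (w', j)) = 0) ->
  (forall w i j, w \in s ->
     M (phi (w, i)) (phi (w, j)) = (pid_mx rho : 'M_q) i j) ->
  \det (M + t *: chain_mx) != 0.
Proof.
move=> rho_last t0 offdiag blk.
(* Transposing turns the row vector of [det0P] into a right kernel vector. *)
apply/negP; rewrite -det_tr => /det0P[v vn0 vA].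
suff h p0 : v 0 (phi p0) = 0.
  by case/eqP: vn0; apply/rowP => a; rewrite mxE -(psiK a) h.
have tn0 : t != 0 by rewrite gt_eqF.
have rowE w i : \sum_j M (phi (w, i)) (phi (w, j)) * v 0 (phi (w, j)) +
    t * v 0 (phi (next (w, i))) = 0.
  have /rowP /(_ (phi (w, i))) := vA; rewrite !mxE => vA0.
  rewrite -[RHS]vA0 [RHS](reindex phi) /=; last first.
    by exists psi => ? _; [exact: phiK|exact: psiK].
  transitivity (\sum_p (M (phi (w, i)) (phi p) * v 0 (phi p) +
      t * ((p == next (w, i))%:R * v 0 (phi p)))); last first.
    apply: eq_bigr => p _; rewrite !mxE phiK (can_eq phiK); ring.
  rewrite big_split -mulr_sumr; congr (_ + _ * _) => /=; last first.
    rewrite (bigD1 (next (w, i)))//= eqxx mul1r big1 ?addr0// => p /negbTE ->.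
    by rewrite mul0r.
  transitivity (\sum_w' \sum_j M (phi (w, i)) (phi (w', j)) * v 0 (phi (w', j))).
    rewrite (bigD1 w)//= [X in _ = _ + X]big1 ?addr0// => w' ww'.
    by rewrite big1// => j _; rewrite offdiag ?mul0r// eq_sym.
  by rewrite pair_bigA; apply: eq_bigr => -[].
have nextE w i : \sum_j M (phi (w, i)) (phi (w, j)) * v 0 (phi (w, j)) = 0 ->
    v 0 (phi (next (w, i))) = 0.
  have := rowE w i => /[swap] ->; rewrite add0r => /eqP.
  by rewrite mulf_eq0 (negbTE tn0) => /eqP.
have pidE (i j : 'I_q) : (pid_mx rho : 'M[F]_q) i j = ((i == j) && (i < rho)%N)%:R.
  by rewrite mxE.
have bs_notin w : (w \in bs) = (w \notin s) by rewrite mem_filter mem_enum andbT.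
have bs_uniq : uniq bs by rewrite filter_uniq ?enum_uniq.
(* The rows of [M] at [last] in the blocks of [s] are zero because [rho <= last], which starts the
   induction; vanishing on one block then forces it on the next. *)
have chain0 j i : (j <= size bs)%N -> v 0 (phi (chain j i)) = 0.
  elim: j i => [|j IH] i jbs.
    have si : nth w0 s i \in s by rewrite mem_nth ?s_size.
    have <- : next (nth w0 s i, last) = chain 0 i.
      rewrite /next /= si eqxx index_uniq ?s_size//.
      by congr (chain 0 _); apply: val_inj; rewrite val_insubd ltn_ord.
    apply: nextE; apply: big1 => j _; rewrite blk// pidE.
    by rewrite ltnNge rho_last andbF mul0r.
  have <- : next (nth w0 bs j, i) = chain j.+1 i.
    by rewrite /next /= -bs_notin mem_nth// index_uniq.
  apply: nextE; apply: big1 => i' _.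
  by have := IH i' (ltnW jbs); rewrite /chain jbs => ->; rewrite mulr0.
case: p0 => w i; have [ws|ws] := boolP (w \in s); last first.
  have wbs : w \in bs by rewrite bs_notin.
  have := chain0 (index w bs) i; rewrite /chain index_mem wbs nth_index//.
  by apply; rewrite ltnW// index_mem.
have [->|il] := eqVneq i last.
  have ws' : (index w s < q)%N by rewrite -s_size index_mem.
  have := chain0 (size bs) (Ordinal ws') (leqnn _).
  by rewrite /chain ltnn /= nth_index.
have := rowE w i; rewrite /next /= ws (negbTE il) (bigD1 i)//= blk// pidE eqxx.
rewrite big1 ?addr0 => [|j /negbTE ji]; last by rewrite blk// pidE eq_sym ji mul0r.
rewrite -mulrDl => /eqP; rewrite mulf_eq0 => /orP[/eqP h|/eqP //].
have : 0 < ((i < rho)%N)%:R + t by rewrite ltr_wpDl.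
by rewrite -h ltxx.
Qed.

End NilpotentPerturbation.

(** * Soft thresholding *)

Section SoftThreshold.
Variable R : realType.

(** For e >= 0 the subtracted term is [u] clamped to [-e, e]; absolute values make continuity
    immediate. *)
Definition soft (e u : R) : R := u - (`|u + e| - `|u - e|) / 2.

Lemma soft_eq0 e u : `|u| <= e -> soft e u = 0.
Proof.
rewrite ler_norml => /andP[h1 h2]; rewrite /soft.
rewrite ger0_norm; last lra.
rewrite ler0_norm; lra.
Qed.

Lemma soft_dist e u : 0 <= e -> `|u - soft e u| <= e.
Proof.
move=> e0; rewrite /soft opprB addrC subrK normrM [`|2^-1|]ger0_norm ?invr_ge0//.
have := ler_dist_dist (u + e) (u - e).
have -> : u + e - (u - e) = 2 * e by ring.
rewrite [`|2 * e|]ger0_norm; last lra.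
lra.
Qed.

Lemma soft_continuous e : continuous (soft e).
Proof.
move=> u; rewrite /soft; apply: cvgB; first exact: cvg_id.
apply: cvgM; last exact: cvg_cst.
apply: cvgB; apply: cvg_norm.
  by apply: cvgD; [exact: cvg_id|exact: cvg_cst].
by apply: cvgB; [exact: cvg_id|exact: cvg_cst].
Qed.

Definition csoft (e : R) (z : R[i]^o) : R[i]^o :=
  soft e (complex.Re z) +i* soft e (complex.Im z).

Lemma csoft_continuous e : continuous (csoft e).
Proof.
apply: cplx_continuous => z; apply: continuous_comp; try exact: soft_continuous.
  exact: Re_continuous.
exact: Im_continuous.
Qed.

Lemma csoft_eq0 e (z : R[i]) : nc z <= e -> csoft e z = 0.
Proof.
move=> ze; rewrite /csoft !soft_eq0//.
  exact: le_trans (Im_le_nc z) ze.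
exact: le_trans (Re_le_nc z) ze.
Qed.

Lemma csoft_dist e (z : R[i]) : 0 <= e -> nc (z - csoft e z) <= 2 * e.
Proof.
move=> e0; apply: le_trans (nc_le_ReIm _) _.
have h1 := soft_dist (complex.Re z) e0; have h2 := soft_dist (complex.Im z) e0.
by case: z h1 h2 => u v /=; lra.
Qed.

End SoftThreshold.

(** * Approximation by invertible elements in the limit *)

Section StableRank.
Variables (R : realType) (x : forall m, X R m).
Arguments x : clear implicits.
Hypothesis x_dense : dense_orbits x.
Variables (A : cstarAlgType R) (iota : forall n, Aalg R n -> A).
Arguments iota : clear implicits.
Hypothesis limA : is_cstar_direct_limit (fun n => @Lambda R x n) iota.

Let hom n : is_star_hom (iota n). Proof. by case: limA => -[]. Qed.

Lemma invertibleM (a b : A) : invertible a -> invertible b -> invertible (a * b).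
Proof.
move=> [a' [aa' a'a]] [b' [bb' b'b]]; exists (b' * a'); split.
  by rewrite mulrA -(mulrA a) bb' mulr1.
by rewrite mulrA -(mulrA b') a'a mulr1.
Qed.

Lemma iota_invertible n (a : Aalg R n) :
  (forall c z, \det (mev c z a) != 0) -> invertible (iota n a).
Proof.
move=> /Aalg_inverse[b [ab ba]]; exists (iota n b).
by rewrite -!(star_homM (hom n)) ab ba (star_hom1 (hom n)).
Qed.

Lemma invertible_closureM (g h a : A) : invertible g -> invertible h ->
  norm_closure [set a : A | invertible a] a ->
  norm_closure [set a : A | invertible a] (g * a * h).
Proof.
move=> ig ih cla e e0.
have K0 : 0 < cnorm g * cnorm h + 1 by rewrite ltr_wpDl// mulr_ge0 ?cnorm_ge0.
have [b ib ab] := cla _ (divr_gt0 e0 K0).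
exists (g * b * h); first by do 2!apply: invertibleM => //.
rewrite -mulrBl -mulrBr (le_lt_trans (cnormM _ _))//.
rewrite (le_lt_trans (ler_wpM2r (cnorm_ge0 _) (cnormM _ _)))//.
move: ab; rewrite ltr_pdivlMr// mulrAC; apply: le_lt_trans.
by rewrite mulrC ler_wpM2l ?cnorm_ge0// lerDl.
Qed.

Lemma near_entries n c (y : X R n) (a : Aalg R n) (e : R) : 0 < e ->
  exists U : set (X R n), [/\ open U, U y &
    forall y', U y' -> forall i j, nc (mev c y a i j - mev c y' a i j) < e].
Proof.
move=> e0; pose f (p : 'I_(r n) * 'I_(r n)) : set (X R n) :=
  [set y' | nc (mev c y a p.1 p.2 - mev c y' a p.1 p.2) < e].
have : nbhs y [set y' | forall p, f p y'].
  apply: (@filter_forall _ _ f _ (nbhs_filter y)) => -[i j]; rewrite /f /=.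
  have := @ev_continuous R n c (a i j) y _ (near_nc _ e0).
  apply: (@filterS _ _ (nbhs_filter y)).
  by move=> y' /=; rewrite !mxE.
rewrite nbhsE => -[U [oU Uy] hU]; exists U; split=> // y' /hU h i j.
exact: (h (i, j)).
Qed.

Lemma approx_of_pid n (b : Aalg R n) c (y : X R n) rho :
  (rho < r n)%N -> mev c y b = pid_mx rho ->
  norm_closure [set a : A | invertible a] (iota n b).
Proof.
move=> rho_lt bpid e e0.
(* Thresholding moves entries by at most 2 e', and [entry_bound] turns this into r(n)^2 * 4 e' = e /
   2. *)
pose e' := e / (8 * (r n)%:R ^+ 2).
have r0 : 0 < (r n)%:R :> R by rewrite ltr0n r_gt0.
have e'0 : 0 < e' by rewrite divr_gt0// mulr_gt0// exprn_gt0.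
pose C : Aalg R n := cmx (fun _ => pid_mx rho).
pose S : Aalg R n := map_mx (map2 (@csoft_continuous R e')) (b - C).
(* Near [y] on summand [c] all entries of [b - C] are below the threshold, so [b'] is exactly
   [pid_mx rho] there. *)
pose b' : Aalg R n := C + S.
have mevS c' z i j : mev c' z S i j = csoft e' (mev c' z (b - C) i j).
  by rewrite !mxE ev_map2.
have bb' : cnorm (iota n (b - b')) <= e / 2.
  have -> : b - b' = (b - C) - S by rewrite opprD addrA.
  have -> : e / 2 = (r n)%:R ^+ 2 * (2 * (2 * e')).
    by rewrite /e'; field; rewrite gt_eqF.
  apply: entry_bound => //; first by rewrite mulr_ge0// ltW.
  by move=> c' z i j; rewrite mevB mxE [X in _ + X]mxE mevS csoft_dist// ltW.
have [U [oU Uy hU]] := near_entries c y b e'0.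
have [y' Uy' [k0 [w1 wc1]]] := dense_word_const c x_dense oU (ex_intro _ y Uy).
have b'pid : mev c y' b' = pid_mx rho.
  apply/matrixP => i j; rewrite mevD mev_cmx mxE mevS csoft_eq0 ?addr0//.
  by rewrite mevB mev_cmx -bpid mxE [X in _ + X]mxE -normcN opprB ltW// hU.
(* Each copy has a zero row at [lst], since rho < r(n); r(n) copies supply a full virtual zero
   block. *)
have [k hk] := word_const_many (r n) wc1.
have lst_lt : ((r n).-1 < r n)%N by rewrite prednK ?r_gt0.
pose lst : 'I_(r n) := Ordinal lst_lt.
have [s0 [w0 sP]] : exists (s : bool -> seq (word n k)) (w0 : word n k),
    forall c', [/\ uniq (s c'), size (s c') = r n
      & {in s c', forall w, word_const x c y' c' w}].
  have [s1 h1] := hk true; have [s2 h2] := hk false.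
  case: s1 h1 => [[_ r0' _]|w0 s1 h1]; first by have := r_gt0 n; rewrite -r0'.
  by exists (fun c' => if c' then w0 :: s1 else s2), w0; case.
pose L := transition (fun n => @Lambda R x n) k.
pose E : Aalg R (k + n) := cmx (fun c' =>
  chain_mx R[i] (@widx n k) (@wunidx n k) (s0 c') w0 lst).
have inv (t : R) : 0 < t -> invertible (iota (k + n)%N (L n b' + t%:C *: E)).
  move=> t0; apply: iota_invertible => c' z; have [us ss hs] := sP c'.
  rewrite mevD mevZ mev_cmx.
  apply: (det_chain_perturbation (@widxK n k) (@wunidxK n k) w0 us ss
    (rho := rho)).
  - by rewrite /= -ltnS prednK ?r_gt0.
  - by rewrite ltcR.
  - move=> w i w' j /negbTE ww'; rewrite mxE transitionE ww'.
    by rewrite -(subrr 0) evB subrr.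
  - by move=> w i j /hs wc; rewrite (word_block _ _ _ _ wc) b'pid.
(* The added 1 keeps the denominator positive and makes t |E| < e / 2 strict. *)
pose t := e / 2 / (cnorm (iota _ E) + 1).
have nE := cnorm_ge0 (iota _ E).
have nE1 : 0 < cnorm (iota _ E) + 1 by rewrite ltr_wpDl.
have t0 : 0 < t by rewrite !divr_gt0.
exists (iota (k + n)%N (L n b' + t%:C *: E)); first exact: inv.
have -> : iota n b - iota (k + n)%N (L n b' + t%:C *: E) =
    iota n (b - b') - t%:C *: iota _ E.
  rewrite (star_homD (hom _)) (star_homZ (hom _)) (star_homB (hom _)).
  by rewrite opprD addrA; case: limA => -[_ ->].
rewrite (le_lt_trans (cnormB _ _))// cnormZ nc_real ger0_norm ?(ltW t0)//.
have : t * cnorm (iota _ E) < e / 2.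
  rewrite /t mulrAC ltr_pdivrMr// ltr_pM2l ?divr_gt0// ltrDl; exact: ltr01.
by lra.
Qed.

Lemma limit_stable_rank_one : stable_rank_one A.
Proof.
apply/seteqP; split=> // a _; move: a.
suff approx n (b : Aalg R n) : norm_closure [set a : A | invertible a] (iota n b).
  move=> a e e0; have e20 : 0 < e / 2 by rewrite divr_gt0.
  have [_ [n [b ->]] ab] := limit_image_dense limA a e20.
  have [g ig bg] := approx n b _ e20; exists g => //.
  have -> : a - g = (a - iota n b) + (iota n b - g) by rewrite addrA subrK.
  by rewrite (le_lt_trans (cnormD _ _))//; lra.
have [h|] := pselect (forall c z, \det (mev c z b) != 0).
  move=> e e0; exists (iota n b); first exact: iota_invertible.
  by rewrite subrr cnorm0.
move=> /existsNP[c /existsNP[y /negP]]; rewrite negbK => /eqP det0.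
pose C := mev c y b.
(* Constant base changes bring the value at [y] to rank normal form; being invertible at every point
   of both summands, they are undone by [invertible_closureM]. *)
pose b1 : Aalg R n :=
  cmx (fun _ => invmx (col_ebase C)) * b * cmx (fun _ => invmx (row_ebase C)).
have b1pid : mev c y b1 = pid_mx (\rank C).
  rewrite !mevM !mev_cmx -/C -[X in _ *m X *m _]mulmx_ebase.
  by rewrite !mulmxA mulVmx ?col_ebase_unit// mul1mx mulmxK ?row_ebase_unit.
have rk : (\rank C < r n)%N.
  rewrite ltn_neqAle rank_leq_row andbT; apply/negP => full.
  have : C \in unitmx by rewrite -row_free_unit.
  by rewrite unitmxE /C det0 unitr0.
have -> : b = cmx (fun _ => col_ebase C) * b1 * cmx (fun _ => row_ebase C).
  apply: mev_inj => c' z; rewrite !mevM !mev_cmx.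
  rewrite !mulmxA mulmxV ?col_ebase_unit// mul1mx.
  by rewrite mulmxKV ?row_ebase_unit.
rewrite 2!(star_homM (hom n)); apply: invertible_closureM.
- apply: iota_invertible => c' z; rewrite mev_cmx.
  by rewrite -unitfE -unitmxE col_ebase_unit.
- apply: iota_invertible => c' z; rewrite mev_cmx.
  by rewrite -unitfE -unitmxE row_ebase_unit.
- exact: approx_of_pid rk b1pid.
Qed.

End StableRank.

(** * Stable finiteness *)

Section StablyFinite.
Variables (R : realType) (A : cstarAlgType R).

(* Schur complements: [a, b; c, D] factors through a and D - c a^-1 b. *)
Lemma matrix_invertible_dense : stable_rank_one A ->
  forall k (M : 'M[A]_k) (e : R), 0 < e -> exists G G' : 'M[A]_k,
    [/\ G *m G' = 1%:M, G' *m G = 1%:M & forall i j, cnorm (M i j - G i j) < e].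
Proof.
move=> sr1 k; elim: k => [|k IH] M e e0.
  by exists 1%:M, 1%:M; rewrite mul1mx; split=> // -[].
pose N : 'M[A]_(1 + k) := M.
have : setT (N 0 0) by []; rewrite -sr1 => /(_ e e0)[a [a' [aa' a'a]] Na].
pose b := ursubmx N; pose c := dlsubmx N; pose D := drsubmx N.
have [H [H' [HH' H'H DH]]] := IH (D - c *m a'%:M *m b) e e0.
have am : (a%:M : 'M[A]_1) *m a'%:M = 1%:M by rewrite -scalar_mxM aa'.
have a'm : (a'%:M : 'M[A]_1) *m a%:M = 1%:M by rewrite -scalar_mxM a'a.
(* The lower right block is chosen so that the Schur complement of [G] is exactly [H]; [G] differs
   from [N] only in the two diagonal blocks. *)
pose G : 'M[A]_(1 + k) := block_mx a%:M b c (H + c *m a'%:M *m b).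
pose lo (u : 'M[A]_(k, 1)) : 'M[A]_(1 + k) := block_mx 1%:M 0 u 1%:M.
pose up (u : 'M[A]_(1, k)) : 'M[A]_(1 + k) := block_mx 1%:M u 0 1%:M.
pose di (u : 'M[A]_1) (w : 'M[A]_k) : 'M[A]_(1 + k) := block_mx u 0 0 w.
have loK u w : u + w = 0 -> lo u *m lo w = 1%:M.
  move=> uw; rewrite /lo mulmx_block !mul1mx !mul0mx !mulmx1 !mulmx0.
  rewrite !addr0 !add0r uw.
  by rewrite -scalar_mx_block.
have upK u w : w + u = 0 -> up u *m up w = 1%:M.
  move=> uw; rewrite /up mulmx_block !mul1mx !mul0mx !mulmx1 !mulmx0.
  rewrite !addr0 !add0r uw.
  by rewrite -scalar_mx_block.
have diM u w u' w' : di u w *m di u' w' = di (u *m u') (w *m w').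
  by rewrite /di mulmx_block !mul0mx !mulmx0 !addr0 !add0r.
have di1 : di 1%:M 1%:M = 1%:M by rewrite /di -scalar_mx_block.
have GE : G = lo (c *m a'%:M) *m di a%:M H *m up (a'%:M *m b).
  rewrite /lo /di /up !mulmx_block !mul1mx !mul0mx !mulmx1 !mulmx0 !addr0 !add0r.
  have -> : c *m a'%:M *m a%:M = c by rewrite -mulmxA a'm mulmx1.
  have -> : a%:M *m (a'%:M *m b) = b by rewrite mulmxA am mul1mx.
  by rewrite addrC mulmxA.
exists G, (up (- (a'%:M *m b)) *m di a'%:M H' *m lo (- (c *m a'%:M))).
split.
- rewrite GE -!mulmxA [up _ *m (up _ *m _)]mulmxA upK ?addNr// mul1mx.
  by rewrite [di _ _ *m (di _ _ *m _)]mulmxA diM am HH' di1 mul1mx loK ?subrr.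
- rewrite GE -!mulmxA [lo _ *m (lo _ *m _)]mulmxA loK ?addNr// mul1mx.
  by rewrite [di _ _ *m (di _ _ *m _)]mulmxA diM a'm H'H di1 mul1mx upK ?subrr.
- move=> i j; have NE : N = block_mx (ulsubmx N) b c D by rewrite submxK.
  rewrite -[M i j]/(N i j) NE /G.
  case: (@split_ordP 1 k i) => i' ->; case: (@split_ordP 1 k j) => j' ->.
  + rewrite [X in X - _]block_mxEul [X in _ - X]block_mxEul !ord1 !mxE eqxx mulr1n.
    by rewrite (_ : lshift k 0 = 0)//; apply: val_inj.
  + by rewrite [X in X - _]block_mxEur [X in _ - X]block_mxEur subrr cnorm0.
  + by rewrite [X in X - _]block_mxEdl [X in _ - X]block_mxEdl subrr cnorm0.
  + rewrite [X in X - _]block_mxEdr [X in _ - X]block_mxEdr.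
    by have := DH i' j'; rewrite !mxE opprD addrA addrAC.
Qed.

(** This submultiplicative norm takes the place of the C*-norm on matrices over [A]. *)
Definition entry_norm m n (M : 'M[A]_(m, n)) : R := \sum_i \sum_j cnorm (M i j).

Lemma entry_norm_ge0 m n (M : 'M[A]_(m, n)) : 0 <= entry_norm M.
Proof. by do 2![apply: sumr_ge0 => ? _]; exact: cnorm_ge0. Qed.

Lemma entry_normD m n (M N : 'M[A]_(m, n)) :
  entry_norm (M + N) <= entry_norm M + entry_norm N.
Proof.
rewrite -big_split; apply: ler_sum => i _; rewrite -big_split.
by apply: ler_sum => j _; rewrite mxE cnormD.
Qed.

Lemma entry_normM m n p (M : 'M[A]_(m, n)) (N : 'M[A]_(n, p)) :
  entry_norm (M *m N) <= entry_norm M * entry_norm N.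
Proof.
rewrite /entry_norm mulr_suml; apply: ler_sum => i _.
apply: (@le_trans _ _ (\sum_j \sum_k cnorm (M i k) * cnorm (N k j))).
  apply: ler_sum => j _; rewrite mxE (le_trans (cnorm_sum _ _ _))//.
  by apply: ler_sum => k _; exact: cnormM.
rewrite exchange_big mulr_suml; apply: ler_sum => k _ /=.
rewrite -mulr_sumr ler_wpM2l ?cnorm_ge0//.
rewrite [leRHS](bigD1 k)//= lerDl; apply: sumr_ge0 => k' _.
by apply: sumr_ge0 => j _; exact: cnorm_ge0.
Qed.

Lemma entry_norm_eq0 m n (M : 'M[A]_(m, n)) : entry_norm M <= 0 -> M = 0.
Proof.
move=> M0; apply/matrixP => i j; rewrite mxE; apply/eqP; rewrite -cnorm_eq0P.
rewrite eq_le cnorm_ge0 andbT; apply: le_trans M0.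
rewrite /entry_norm (bigD1 i)//= (bigD1 j)//= -addrA lerDl addr_ge0//.
  by apply: sumr_ge0 => ? _; exact: cnorm_ge0.
by do 2![apply: sumr_ge0 => ? _]; exact: cnorm_ge0.
Qed.

(* An isometry v close to an invertible g is unitary: p = 1 - v v^* satisfies
   p = p (g - v) g^-1, and g^-1 is bounded in terms of v^* alone. *)
Lemma stable_rank_one_stably_finite : stable_rank_one A -> stably_finite A.
Proof.
move=> sr1 n n_gt0 v vv; pose u : 'M[A]_n := star v; pose w : 'M[A]_n := v.
have uw : u *m w = 1%:M by exact: vv.
suff : w *m u = 1%:M by [].
have nn : 0 < (n * n)%:R :> R by rewrite ltr0n muln_gt0 n_gt0.
have Ku := entry_norm_ge0 u.
(* With eta |u| <= 1/4, the estimate |g'| <= |u| + |g'| / 4 gives |g'| <= 2 |u|, and then |p| <= |p|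
   / 2 forces p = 0. *)
pose eta := (4 * (entry_norm u + 1))^-1.
have eta0 : 0 < eta by rewrite invr_gt0; lra.
have eta_u : 4 * (eta * entry_norm u) <= 1.
  have : eta * (4 * (entry_norm u + 1)) = 1 by rewrite mulVf// gt_eqF//; lra.
  by move: eta0; nra.
have [g [g' [gg' g'g wg]]] := matrix_invertible_dense sr1 w (divr_gt0 eta0 nn).
have wg_le : entry_norm (w - g) <= eta.
  have -> : eta = \sum_(i < n) \sum_(j < n) eta / (n * n)%:R.
    by rewrite !sumr_const !card_ord -mulrnA -[RHS]mulr_natr divfK// gt_eqF.
  by do 2![apply: ler_sum => ? _]; rewrite !mxE ltW// wg.
have gw_le : entry_norm (g - w) <= eta.
  apply: le_trans wg_le; do 2![apply: ler_sum => ? _].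
  by rewrite !mxE cnormBC.
have g'_le : entry_norm g' <= 2 * entry_norm u.
  have g'E : g' = u + u *m (w - g) *m g'.
    by rewrite mulmxBr uw mulmxBl mul1mx -mulmxA gg' mulmx1 addrC subrK.
  have h1 : entry_norm g' <= entry_norm u + entry_norm (u *m (w - g) *m g').
    by rewrite {1}g'E entry_normD.
  have h2 : entry_norm (u *m (w - g) *m g') <= entry_norm u * eta * entry_norm g'.
    rewrite (le_trans (entry_normM _ _))// ler_wpM2r ?entry_norm_ge0//.
    by rewrite (le_trans (entry_normM _ _))// ler_wpM2l.
  have := entry_norm_ge0 g'; nra.
pose p := 1%:M - w *m u.
have pw : p *m w = 0 by rewrite mulmxBl mul1mx -mulmxA uw mulmx1 subrr.
have pE : p = p *m (g - w) *m g' by rewrite mulmxBr pw subr0 -mulmxA gg' mulmx1.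
have p_le : entry_norm p <= entry_norm p * eta * (2 * entry_norm u).
  rewrite {1}pE (le_trans (entry_normM _ _))//.
  rewrite ler_pM ?entry_norm_ge0//.
  by rewrite (le_trans (entry_normM _ _))// ler_wpM2l ?entry_norm_ge0.
have p0 : p = 0.
  by apply: entry_norm_eq0; have := entry_norm_ge0 p; nra.
by apply/eqP; rewrite eq_sym -subr_eq0 -/p p0.
Qed.

End StablyFinite.

Theorem lemma6p5 (R : realType) (x : forall m : nat, X R m)
    (x_dense : dense_orbits x)
    (A : cstarAlgType R) (iota : forall n : nat, Aalg R n -> A)
    (A_limit : is_cstar_direct_limit (fun n : nat => @Lambda R x n) iota) :
  stably_finite A /\ simple_algebra A /\ stable_rank_one A.
Proof.
have sr1 := limit_stable_rank_one x_dense A_limit.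
split; first exact: stable_rank_one_stably_finite.
by split; [exact: (limit_simple x_dense A_limit)|exact: sr1].
Qed.
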